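(* Let $\underline{C}=(C_1,\ldots,C_d)$ be a row contraction on a Hilbert space $\mathcal{H}_C$ and $\mathcal{D}$ a Hilbert space. (i) If $M_\theta:\Gamma\otimes\mathcal{D}\to\Gamma\otimes\mathcal{D}_C$ is a contractive multi-analytic operator with injective symbol $\theta:\mathcal{D}\to\Gamma\otimes\mathcal{D}_C$, then there exist a row contraction $\underline{A}$ on some Hilbert space $\mathcal{H}_A$ such that $M_{\theta_A}$ is purely contractive and satisfies the Szeg\''o condition, a resolving contraction $\gamma:\mathcal{D}_{*,A}\to\mathcal{D}_C$, and a unitary $\sigma:\mathcal{D}\to\mathcal{D}_{*,\gamma}\oplus\mathcal{D}_A$ such that $$\theta=\begin{bmatrix}D_{*,\gamma}&(I_\Gamma\otimes\gamma)\theta_A\end{bmatrix}\sigma,$$ where $D_{*,\gamma}x$ is regarded as $e_0\otimes D_{*,\gamma}x\in\Gamma\otimes\mathcal{D}_C$. (ii) Conversely, if $\underline{A}$ is a row contraction such that $M_{\theta_A}$ is purely contractive and satisfies the Szeg\''o condition, $\gamma:\mathcal{D}_{*,A}\to\mathcal{D}_C$ is a resolving contraction, and $\sigma:\mathcal{D}\to\mathcal{D}_{*,\gamma}\oplus\mathcal{D}_A$ is a unitary, then $\theta:=\begin{bmatrix}D_{*,\gamma}&(I_\Gamma\otimes\gamma)\theta_A\end{bmatrix}\sigma$ is the injective symbol of a contractive multi-analytic operator $M_\theta:\Gamma\otimes\mathcal{D}\to\Gamma\otimes\mathcal{D}_C$.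
   Context: A tuple $\underline{T}=(T_1,\ldots,T_d)$ of bounded operators on a Hilbert space $\mathcal{H}$ is a row contraction if $\sum_{i=1}^d T_iT_i^*\le I$; we view $\underline{T}=[T_1\ \cdots\ T_d]:\bigoplus_{i=1}^d\mathcal{H}\to\mathcal{H}$. Defect operators and spaces: $D_T=(I-\underline{T}^*\underline{T})^{1/2}$ on $\bigoplus_{i=1}^d\mathcal{H}$, $D_{*,T}=(I-\underline{T}\,\underline{T}^* )^{1/2}$ on $\mathcal{H}$, $\mathcal{D}_T=\overline{\mathrm{ran}}\,D_T$, $\mathcal{D}_{*,T}=\overline{\mathrm{ran}}\,D_{*,T}$. For a contraction $\gamma:\mathcal{D}_{*,A}\to\mathcal{D}_C$: $D_{*,\gamma}=(I-\gamma\gamma^* )^{1/2}$ on $\mathcal{D}_C$ and $\mathcal{D}_{*,\gamma}=\overline{\mathrm{ran}}\,D_{*,\gamma}$. $\tilde\Lambda$ is the set of all finite words $\alpha=(\alpha_1,\ldots,\alpha_n)$ in $\{1,\ldots,d\}$ (including the empty word), $T_\alpha=T_{\alpha_1}\cdots T_{\alpha_n}$ ($T_\emptyset=I$). $\Gamma$ is the full Fock space over $\mathbb{C}^d$ with vacuum vector $e_0$; $e_\alpha=e_{\alpha_1}\otimes\cdots\otimes e_{\alpha_n}$ ($e_\emptyset=e_0$); $L_ix=e_i\otimes x$ are the left creation operators. $P_k:\bigoplus_{i=1}^d\mathcal{H}\to\mathcal{H}$ is the $k$-th coordinate projection. A bounded operator $M:\Gamma\otimes\mathcal{H}_1\to\Gamma\otimes\mathcal{H}_2$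 is multi-analytic if $M(L_i\otimes I)=(L_i\otimes I)M$ for all $i$; it is determined by its symbol $\theta=M|_{e_0\otimes\mathcal{H}_1}$ (regarded as a map $\mathcal{H}_1\to\Gamma\otimes\mathcal{H}_2$), and one writes $M=M_\theta$. For a contractive multi-analytic $M_\theta:\Gamma\otimes\mathcal{D}\to\Gamma\otimes\mathcal{L}$: it is purely contractive if $\|P_{e_0\otimes\mathcal{L}}\theta(x)\|<\|x\|$ for all $0\ne x\in\mathcal{D}$; it satisfies the Szeg\''o condition if $\overline{\Delta(\Gamma\otimes\mathcal{D})}=\overline{\Delta((\Gamma\otimes\mathcal{D})\ominus(e_0\otimes\mathcal{D}))}$, where $\Delta=(I-M_\theta^*M_\theta)^{1/2}$. The characteristic function (symbol) of $\underline{A}$ is $\theta_A:\mathcal{D}_A\to\Gamma\otimes\mathcal{D}_{*,A}$, $\theta_Ax=-e_0\otimes\underline{A}x+\sum_{k=1}^d\sum_{\alpha}e_k\otimes e_\alpha\otimes D_{*,A}A_\alpha^*P_kD_Ax$; it is the symbol of a contractive multi-analytic operator $M_{\theta_A}$. A contraction $\gamma:\mathcal{D}_{*,A}\to\mathcal{D}_C$ is resolving if for every $h\in\mathcal{H}_A$: $\gamma D_{*,A}A_\alpha^*h=0$ for all $\alpha\in\tilde\Lambda$ implies $D_{*,A}A_\alpha^*h=0$ for all $\alpha\in\tilde\Lambda$. *)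

(* Defs.v *)
From HB Require Import structures.
From mathcomp Require Import all_boot all_order all_algebra.
From mathcomp Require Import finmap boolp classical_sets functions reals topology normedtype.
From mathcomp Require Import complex ring.
From mathcomp.analysis.showcase Require Import summability.
Set Implicit Arguments. Unset Strict Implicit. Unset Printing Implicit Defensive.
Import Order.TTheory GRing.Theory Num.Theory.
Import numFieldNormedType.Exports.
Local Open Scope classical_set_scope.
Local Open Scope ring_scope.

Section CauchySchwarz.
Variables (R : realType) (H : lmodType R[i]) (dot : H -> H -> R[i]).
Hypothesis dot_linear : forall y : H, scalar (dot^~ y).
Hypothesis dotC : forall x y : H, dot x y = (dot y x)^*.
Hypothesis dot_ge0 : forall x : H, 0 <= dot x x.
Hypothesis dot_eq0 : forall x : H, dot x x = 0 -> x = 0.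

Let dotDl x y z : dot (x + y) z = dot x z + dot y z.
Proof. by have := dot_linear z 1 x y; rewrite scale1r mul1r. Qed.
Let dot0l z : dot 0 z = 0.
Proof. by have /(congr1 (fun t => t - dot 0 z)) := dotDl 0 0 z; rewrite addr0 subrr addrK. Qed.
Let dotZl a x z : dot (a *: x) z = a * dot x z.
Proof. by have := dot_linear z a x 0; rewrite addr0 dot0l addr0. Qed.
Let dotDr x y z : dot z (x + y) = dot z x + dot z y.
Proof. by rewrite (dotC z x) (dotC z y) -rmorphD -dotDl /= -dotC. Qed.
Let dotZr a x z : dot z (a *: x) = a^* * dot z x.
Proof. by rewrite (dotC z x) -rmorphM -dotZl /= -dotC. Qed.

Lemma CauchySchwarz_sqr x y : `|dot x y| ^+ 2 <= dot x x * dot y y.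
Proof.
have [y0|y0] := eqVneq (dot y y) 0.
  by rewrite (dot_eq0 y0) dotC dot0l conjC0 normr0 expr0n dot0l mulr0.
have ygt0 : 0 < dot y y by rewrite lt_def y0 dot_ge0.
pose a := dot x y / dot y y.
have := dot_ge0 (x + (- a) *: y).
rewrite dotDl !dotDr dotZl !dotZr dotZl (dotC y x).
have yR : (dot y y)^* = dot y y by apply/CrealP/ger0_real/dot_ge0.
have aR : a^* = (dot x y)^* / dot y y.
  by rewrite /a rmorphM /= fmorphV /= yR.
rewrite rmorphN /= aR /a.
set b := dot x y; set n := dot y y.
have n0 : n != 0 by [].
have -> : dot x x + - (b^* / n) * b + (- (b / n) * b^* + - (b^* / n) * (- (b / n) * n))
  = dot x x - (b * b^*) / n.
  by field.
by rewrite subr_ge0 ler_pdivrMr// -normCK.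
Qed.

End CauchySchwarz.

(* Complex Hilbert spaces: complete normed modules over R[i] whose norm comes
   from an inner product, linear in its first argument. *)
HB.mixin Record NormedModule_hasDot (R : realType) H & NormedModule R[i] H := {
  dot : H -> H -> R[i];
  dot_linear : forall y : H, scalar (dot^~ y);
  dotC : forall x y : H, dot x y = (dot y x)^*;
  dotxx : forall x : H, dot x x = `|x| ^+ 2 }.

#[short(type="preHilbertType")]
HB.structure Definition PreHilbert (R : realType) :=
  {H of NormedModule R[i] H & NormedModule_hasDot R H}.

#[short(type="hilbertType")]
HB.structure Definition Hilbert (R : realType) :=
  {H of PreHilbert R H & Complete H}.

HB.factory Record Lmodule_hasDot (R : realType) H & GRing.Lmodule R[i] H := {
  dot : H -> H -> R[i];
  dot_linear : forall y : H, scalar (dot^~ y);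
  dotC : forall x y : H, dot x y = (dot y x)^*;
  dot_ge0 : forall x : H, 0 <= dot x x;
  dot_eq0 : forall x : H, dot x x = 0 -> x = 0 }.

HB.builders Context R H & Lmodule_hasDot R H.
Let norm (x : H) : R[i] := sqrtC (dot x x).

Let dotDl x y z : dot (x + y) z = dot x z + dot y z.
Proof. by have := dot_linear z 1 x y; rewrite scale1r mul1r. Qed.
Let dot0l z : dot 0 z = 0.
Proof. by have /(congr1 (fun t => t - dot 0 z)) := dotDl 0 0 z; rewrite addr0 subrr addrK. Qed.
Let dotZl a x z : dot (a *: x) z = a * dot x z.
Proof. by have := dot_linear z a x 0; rewrite addr0 dot0l addr0. Qed.
Let dotDr x y z : dot z (x + y) = dot z x + dot z y.
Proof. by rewrite (dotC z x) (dotC z y) -rmorphD -dotDl /= -dotC. Qed.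
Let dotZr a x z : dot z (a *: x) = a^* * dot z x.
Proof. by rewrite (dotC z x) -rmorphM -dotZl /= -dotC. Qed.

Let normE x : norm x ^+ 2 = dot x x. Proof. exact: sqrtCK. Qed.
Let norm_ge0 x : 0 <= norm x. Proof. by rewrite sqrtC_ge0 dot_ge0. Qed.

Let CauchySchwarz x y : `|dot x y| <= norm x * norm y.
Proof.
rewrite -(@ler_pXn2r _ 2)// ?nnegrE ?mulr_ge0// exprMn !normE.
exact: (CauchySchwarz_sqr dot_linear dotC dot_ge0 dot_eq0).
Qed.

Let ler_normD x y : norm (x + y) <= norm x + norm y.
Proof.
have D2 : dot x y + (dot x y)^* <= (norm x * norm y) *+ 2.
  rewrite -[leRHS]mulr_natr -ler_pdivrMr// -ReE.
  apply: le_trans (CauchySchwarz x y).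
  exact: (leif_Re_Creal (dot x y)).
rewrite -(@ler_pXn2r _ 2)// ?nnegrE ?addr_ge0// normE sqrrD !normE.
rewrite dotDl !dotDr (dotC y x) /= -addrA (addrA (dot x y)) addrA.
by rewrite lerD2r lerD2l.
Qed.

Let normrZ l x : norm (l *: x) = `|l| * norm x.
Proof.
rewrite /norm dotZl dotZr mulrA -normCK sqrtCM ?nnegrE ?exprn_ge0 ?dot_ge0//.
by rewrite exprCK.
Qed.

Let normr0_eq0 x : norm x = 0 -> x = 0.
Proof. by move=> /eqP; rewrite sqrtC_eq0 => /eqP/dot_eq0. Qed.

HB.instance Definition _ := Lmodule_isNormed.Build R[i] H ler_normD normrZ normr0_eq0.

Let dotxx (x : H) : dot x x = `|x| ^+ 2. Proof. by rewrite -[dot x x]normE. Qed.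
HB.instance Definition _ := NormedModule_hasDot.Build R H dot_linear dotC dotxx.
HB.end.

Section PreHilbertTheory.
Context {R : realType} {H : preHilbertType R}.
Implicit Types x y z : H.

Lemma dotDl x y z : dot (x + y) z = dot x z + dot y z.
Proof. by have := dot_linear z 1 x y; rewrite scale1r mul1r. Qed.
Lemma dot0l z : dot 0 z = 0.
Proof. by have /(congr1 (fun t => t - dot 0 z)) := dotDl 0 0 z; rewrite addr0 subrr addrK. Qed.
Lemma dotZl a x z : dot (a *: x) z = a * dot x z.
Proof. by have := dot_linear z a x 0; rewrite addr0 dot0l addr0. Qed.
Lemma dotDr x y z : dot z (x + y) = dot z x + dot z y.
Proof. by rewrite (dotC z x) (dotC z y) -rmorphD -dotDl /= -dotC. Qed.
Lemma dot0r z : dot z 0 = 0.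
Proof. by rewrite dotC dot0l conjC0. Qed.
Lemma dotZr a x z : dot z (a *: x) = a^* * dot z x.
Proof. by rewrite (dotC z x) -rmorphM -dotZl /= -dotC. Qed.

Lemma CauchySchwarz x y : `|dot x y| <= `|x| * `|y|.
Proof.
rewrite -(@ler_pXn2r _ 2)// ?nnegrE ?mulr_ge0// exprMn -!dotxx.
apply: (CauchySchwarz_sqr (@dot_linear R H) (@dotC R H)) => z; rewrite dotxx.
  by rewrite exprn_ge0.
by move=> /eqP; rewrite expf_eq0/= normr_eq0 => /eqP.
Qed.

HB.instance Definition _ := bilinear_isBilinear.Build R[i] H H R[i] *%R (Num.conj \; *%R) (@dot R H)
 (conj (@dot_linear R H) (fun u a x y => etrans (dotDr _ _ _) (congr1 (+%R^~ _) (dotZr _ _ _)))).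

HB.instance Definition _ := isHermitianSesquilinear.Build R[i] H false Num.conj (@dot R H)
  (fun x y => etrans (dotC x y) (esym (mul1r _))).

Let dot_gt0 (u : H) : u != 0 -> 0 < dot u u.
Proof. by move=> u0; rewrite dotxx exprn_gt0// normr_gt0. Qed.

HB.instance Definition _ := isDotProduct.Build R[i] H (@dot R H) dot_gt0.

End PreHilbertTheory.


Section ComplexLimits.
Variable R : realType.
Local Notation C := R[i]^o.

Lemma complex_cauchy_cvg (F : set_system C) : ProperFilter F -> cauchy F -> cvg F.
Proof.
move=> FF /cauchy_ballP Fc.
have part (p : R[i] -> R) :
    (forall z, `|p z|%:C%C <= `|z|) -> (forall z w, p (z - w) = p z - p w) ->
    cvg ((p z : R^o) @[z --> F]).
  move=> pN pB; apply: cauchy_cvg; apply/cauchyP => e e_gt0.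
  have e0 : 0 < e%:C%C :> R[i] by rewrite ltcR.
  have [x Fx] := (cauchyP F).1 ((cauchy_ballP F).1 Fc) _ e0.
  exists (p x); rewrite /nbhs /=; apply: filterS Fx => z.
  rewrite -!ball_normE /= => xz; rewrite -ltcR -pB.
  exact: le_lt_trans (pN _) xz.
have /cvg_ex[/= a Fa] : cvg ((complex.Re z : R^o) @[z --> F]).
  by apply: part => [z|z w]; [exact: normc_ge_Re | case: z w => ? ? []].
have /cvg_ex[/= b Fb] : cvg ((complex.Im z : R^o) @[z --> F]).
  apply: part => [z|z w]; last by case: z w => ? ? [].
  rewrite normc_def lecR -{1}sqrtr_sqr ler_wsqrtr// lerDr.
  exact: sqr_ge0.
apply: (@cvgP C F ((a +i* b)%C : C)).
apply/(@cvgrPdist_lt R[i] C _ F _ id (a +i* b)%C) => e e0.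
have eE : e = (complex.Re e)%:C%C by rewrite RRe_real// gtr0_real.
move: e0; rewrite eE ltcR => e0.
have e20 : 0 < complex.Re e / 2 by rewrite divr_gt0.
have ha : F [set z | `|a - complex.Re z| < complex.Re e / 2] by exact: (cvgrPdist_lt _ _).1 Fa _ e20.
have hb : F [set z | `|b - complex.Im z| < complex.Re e / 2] by exact: (cvgrPdist_lt _ _).1 Fb _ e20.
suff : F [set z : C | `|(a +i* b)%C - z| < (complex.Re e)%:C%C] by [].
apply: filterS2 ha hb => -[x y] /= hx hy.
rewrite (_ : (a +i* b)%C - (x +i* y)%C = (a - x)%:C%C + 'i%C * (b - y)%:C%C); last first.
  by rewrite [LHS]complexE.
apply: le_lt_trans (ler_normD _ _) _; rewrite normrM.
have -> : `|'i%C| = 1 :> R[i] by rewrite normc_def /= expr0n expr1n add0r sqrtr1.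
have nR (t : R) : `|t%:C%C| = `|t|%:C%C :> R[i].
  by rewrite normc_def /= expr0n addr0 sqrtr_sqr.
by rewrite mul1r !nR -raddfD /= ltcR [ltRHS]splitr ltrD.
Qed.

Lemma lim_ge0 (T : Type) (F : set_system T) (f : T -> C) (l : C) :
  ProperFilter F -> f @ F --> l -> (\forall x \near F, 0 <= (f x : R[i])) -> 0 <= (l : R[i]).
Proof.
move=> FF fl f0; suff -> : l = `|l| :> R[i] by [].
apply: (@cvg_unique C (@norm_hausdorff _ _) (f @ F) _ _ _ fl).
have H : (fun x => `|f x| : C) @ F --> (`|l| : C) by exact: (@cvg_norm R[i] C).
apply: cvg_trans H; apply: near_eq_cvg.
by apply: filterS f0 => x x0; rewrite /= ger0_norm.
Qed.

End ComplexLimits.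

#[local] Existing Instance totally_filter.

Section Summation.
Variables (R : realType) (I : choiceType).
Local Notation C := R[i]^o.
Implicit Types (a : I -> C) (A B : {fset I}).

Lemma partial_sumE a A : partial_sum a A = \sum_(i <- A) a i.
Proof. by rewrite big_seq_fsetE. Qed.

Lemma sum_fset_split a A B : (A `<=` B)%fset ->
  \sum_(i <- B) a i = \sum_(i <- A) a i + \sum_(i <- B | i \notin A) a i.
Proof.
move=> AB; rewrite (big_fsetID _ (mem A)) /=; congr (_ + _); last by rewrite big_fset.
apply: eq_fbigl => i; rewrite !inE /=.
by have [iA|] := boolP (i \in A); rewrite ?andbF// (fsubsetP AB).
Qed.

Lemma abs_summable_cvg a (M : R[i]) :
  (forall A, \sum_(i <- A) `|a i| <= M) -> cvg (partial_sum a @ totally).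
Proof.
move=> aM.
pose s A : R := complex.Re (\sum_(i <- A) `|a i|).
have sE A : \sum_(i <- A) `|a i| = (s A)%:C%C.
  by rewrite RRe_real// ger0_real// sumr_ge0.
have supS : has_sup (range s).
  split; first by exists (s fset0); exists fset0.
  exists (complex.Re M) => _ [A _ <-].
  by have := aM A; rewrite lecE => /andP[].
apply: complex_cauchy_cvg; apply/(@cauchyP R[i] C) => e e_gt0.
have eE : e = (complex.Re e)%:C%C by rewrite RRe_real// gtr0_real.
move: e_gt0; rewrite eE ltcR => e_gt0.
have [_ [A0 _ <-] sA0] := sup_adherent e_gt0 supS.
exists (partial_sum a A0); exists A0 => //= B /= A0B.
rewrite -ball_normE /= !partial_sumE (sum_fset_split _ A0B) opprD addrA subrr sub0r normrN.
apply: le_lt_trans (ler_norm_sum _ _ _) _.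
have : \sum_(i <- B) `|a i| = \sum_(i <- A0) `|a i| + \sum_(i <- B | i \notin A0) `|a i|.
  exact: (sum_fset_split (fun i => `|a i| : C)).
rewrite !sE => sBE.
have -> : \sum_(i <- B | i \notin A0) `|a i| = (s B - s A0)%:C%C.
  by rewrite raddfB /= sBE addrC addKr.
rewrite ltcR ltrBlDl -ltrBlDr; apply: le_lt_trans sA0; rewrite lerD2r.
by apply: (sup_upper_bound supS); exists B.
Qed.


Lemma bounded_lim_le a (M : R[i]) (l : C) : partial_sum a @ totally --> l ->
  (forall A, \sum_(i <- A) a i <= M :> R[i]) -> (l : R[i]) <= M.
Proof.
move=> al aM.
rewrite -subr_ge0; apply: (@lim_ge0 R {fset I} (@totally I) (fun A => (M : C) - partial_sum a A) ((M : C) - l)).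
  apply: (@cvgB R[i] C); [exact: (@cvg_cst C) | exact: al].
by apply: nearW => A; rewrite subr_ge0 partial_sumE.
Qed.

Lemma lim_ge_partial_sum a (l : C) A : partial_sum a @ totally --> l ->
  (forall i, 0 <= a i :> R[i]) -> \sum_(i <- A) a i <= (l : R[i]).
Proof.
move=> al a0.
rewrite -subr_ge0; apply: (@lim_ge0 R {fset I} (@totally I) (fun B => partial_sum a B - (\sum_(i <- A) a i : C)) (l - _)).
  apply: (@cvgB R[i] C); [exact: al | exact: (@cvg_cst C)].
exists A => //= B AB; rewrite partial_sumE (sum_fset_split _ AB) addrAC subrr add0r.
exact: sumr_ge0.
Qed.

End Summation.


(* The Hilbert direct sum of copies of H indexed by I. It is used with
   I = 'I_d for the sum of d copies of H, and with I the set of words for the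
   tensor product of the full Fock space with H. *)
Section L2.
Variables (R : realType) (I : choiceType) (H : hilbertType R).
Local Notation C := R[i]^o.

Definition square_summable (f : I -> H) : Prop :=
  exists M : R[i], forall A : {fset I}, \sum_(i <- A) `|f i| ^+ 2 <= M.

Definition l2_pred : {pred I -> H} := fun f => `[< square_summable f >].

Record l2 := L2 { l2_fun :> I -> H; l2P : l2_fun \in l2_pred }.

HB.instance Definition _ := [isSub of l2 for l2_fun].
HB.instance Definition _ := [Choice of l2 by <:].

Let sqr_normD (x y : H) : `|x + y| ^+ 2 <= `|x| ^+ 2 *+ 2 + `|y| ^+ 2 *+ 2.
Proof.
have h : `|x + y| ^+ 2 + `|x - y| ^+ 2 = `|x| ^+ 2 *+ 2 + `|y| ^+ 2 *+ 2.
  rewrite -!dotxx -scaleN1r !(dotDl, dotDr, dotZl, dotZr) rmorphN1.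
  ring.
by rewrite -h lerDl exprn_ge0.
Qed.

Let l2_submod : submod_closed l2_pred.
Proof.
split.
  by apply/asboolP; exists 0 => A; rewrite big1// => i _; rewrite normr0 expr0n.
move=> k f g /asboolP[M fM] /asboolP[N gN]; apply/asboolP.
exists (`|k| ^+ 2 * M *+ 2 + N *+ 2) => A.
apply: le_trans (_ : \sum_(i <- A) (`|k| ^+ 2 * `|f i| ^+ 2 *+ 2 + `|g i| ^+ 2 *+ 2) <= _).
  by apply: ler_sum => i _; apply: le_trans (sqr_normD _ _) _; rewrite normrZ exprMn.
rewrite big_split/= !sumrMnl -mulr_sumr lerD// lerMn2r//=.
by rewrite ler_wpM2l// exprn_ge0.
Qed.

HB.instance Definition _ := GRing.isSubmodClosed.Build R[i] (I -> H) l2_pred l2_submod.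
HB.instance Definition _ := [SubChoice_isSubLmodule of l2 by <:].

Definition l2_dot (f g : l2) : R[i] :=
  lim (partial_sum (fun i => dot (f i) (g i) : C) @ totally).

Lemma l2_dot_cvg (f g : l2) :
  partial_sum (fun i => dot (f i) (g i) : C) @ totally --> (l2_dot f g : C).
Proof.
have /asboolP[M fM] := l2P f; have /asboolP[N gN] := l2P g.
suff : cvg (partial_sum (fun i => dot (f i) (g i) : C) @ totally) by [].
apply: (@abs_summable_cvg _ _ _ (M + N)) => A.
apply: le_trans (lerD (fM A) (gN A)); rewrite -big_split/=; apply: ler_sum => i _.
apply: le_trans (CauchySchwarz _ _) _.
rewrite -subr_ge0; set a := `|f i|; set b := `|g i|.
have -> : a ^+ 2 + b ^+ 2 - a * b = ((a - b) ^+ 2 + (a ^+ 2 + b ^+ 2)) / 2 by field.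
have ab0 : 0 <= (a - b) ^+ 2 by rewrite real_exprn_even_ge0// rpredB// ger0_real// normr_ge0.
have a0 : 0 <= a ^+ 2 by rewrite exprn_ge0 ?normr_ge0.
have b0 : 0 <= b ^+ 2 by rewrite exprn_ge0 ?normr_ge0.
by apply: divr_ge0; rewrite ?ler0n// !addr_ge0.
Qed.

Lemma l2_dotE (f g : l2) (l : R[i]) :
  partial_sum (fun i => dot (f i) (g i) : C) @ totally --> (l : C) -> l2_dot f g = l.
Proof.
move=> fgl; apply: (@cvg_unique C (@norm_hausdorff R[i] C) _ _ _ _ (@l2_dot_cvg f g) fgl).
Qed.

Let dot_lin (h : l2) : scalar (l2_dot^~ h).
Proof.
move=> k f g; apply: l2_dotE.
have H0 := @cvgD R[i] C _ _ _ _ _ _ _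
  (@cvgZr R[i] C _ _ _ k _ _ (@l2_dot_cvg f h)) (@l2_dot_cvg g h).
have tF := @filter_filter _ _ (@totally_filter I).
move: (H0 tF tF) => {}H0.
refine (cvg_trans _ H0); apply: near_eq_cvg; apply: nearW => A /=.
rewrite -[LHS]/(k * partial_sum (fun i => dot (f i) (h i) : C) A +
  partial_sum (fun i => dot (g i) (h i) : C) A).
rewrite !partial_sumE mulr_sumr -big_split/=; apply: eq_bigr => i _.
by rewrite [RHS](dot_linear (h i)).
Qed.

Let conj_cvg (T : Type) (F : set_system T) (FF : Filter F) (u : T -> C) (l : C) :
  u @ F --> l -> (fun x => (u x : R[i])^* : C) @ F --> ((l : R[i])^* : C).
Proof.
move=> /(@cvgrPdist_lt R[i] C) ul; apply/(@cvgrPdist_lt R[i] C) => e e0.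
by apply: filterS (ul _ e0) => x; rewrite -rmorphB /= norm_conjC.
Qed.

Let dot_sym (f g : l2) : l2_dot f g = (l2_dot g f)^*.
Proof.
apply: l2_dotE; have H0 := conj_cvg (@filter_filter _ _ (@totally_filter I)) (@l2_dot_cvg g f).
refine (cvg_trans _ H0); apply: near_eq_cvg; apply: nearW => A /=.
rewrite !partial_sumE rmorph_sum; apply: eq_bigr => i _.
by rewrite [RHS]dotC.
Qed.

Let dot_ge_sum (f : l2) (A : {fset I}) : \sum_(i <- A) `|f i| ^+ 2 <= l2_dot f f.
Proof.
have -> : \sum_(i <- A) `|f i| ^+ 2 = \sum_(i <- A) dot (f i) (f i).
  by apply: eq_bigr => i _; rewrite dotxx.
apply: (lim_ge_partial_sum A (@l2_dot_cvg f f)) => i.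
by rewrite dotxx exprn_ge0.
Qed.

Let dot_pos (f : l2) : 0 <= l2_dot f f.
Proof. by have := dot_ge_sum f fset0; rewrite big_seq_fset0. Qed.

Let dot_def (f : l2) : l2_dot f f = 0 -> f = 0.
Proof.
move=> f0; apply/val_inj/funext => i /=.
have := dot_ge_sum f [fset i]%fset; rewrite f0 big_seq_fset1.
move=> fi0; have : `|f i| ^+ 2 == 0 by rewrite eq_le fi0 exprn_ge0.
by rewrite expf_eq0/= normr_eq0 => /eqP.
Qed.

HB.instance Definition _ := Lmodule_hasDot.Build R l2 dot_lin dot_sym dot_pos dot_def.

Lemma l2_norm_ge (f : l2) (A : {fset I}) : \sum_(i <- A) `|f i| ^+ 2 <= `|f| ^+ 2.
Proof. by rewrite -[leRHS]dotxx. Qed.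

Lemma l2_norm_le (f : l2) (M : R[i]) :
  (forall A : {fset I}, \sum_(i <- A) `|f i| ^+ 2 <= M) -> `|f| ^+ 2 <= M.
Proof.
move=> fM; rewrite -[leLHS]dotxx; apply: (bounded_lim_le (@l2_dot_cvg f f)) => A.
by apply: le_trans (fM A); apply: ler_sum => i _; rewrite dotxx.
Qed.


Let coord_cauchy (F : set_system l2) (i : I) : ProperFilter F -> cauchy F ->
  cvg ((f i : H) @[f --> F]).
Proof.
move=> FF /(cauchyP F) Fc; apply: cauchy_cvg; apply/cauchyP => e e0.
have [f0 Ff0] := Fc e e0.
exists (f0 i); rewrite /nbhs /=; apply: filterS Ff0 => f.
rewrite -!ball_normE /=; apply: le_lt_trans.
rewrite -(@ler_pXn2r _ 2)// ?nnegrE//.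
by have := l2_norm_ge (f0 - f) [fset i]%fset; rewrite big_seq_fset1.
Qed.

Let l2_complete (F : set_system l2) : ProperFilter F -> cauchy F -> cvg F.
Proof.
move=> FF Fc; have /(cauchyP F) Fce := Fc.
pose g i : H := lim ((f i : H) @[f --> F]).
have gE i : (f i : H) @[f --> F] --> g i by apply: coord_cauchy.
have key e f0 : 0 < e -> F (ball f0 e) ->
    forall A : {fset I}, \sum_(i <- A) `|f0 i - g i| ^+ 2 <= e ^+ 2.
  move=> e0 Ff0 A; rewrite -subr_ge0.
  apply: (@lim_ge0 R l2 F (fun f => e ^+ 2 - \sum_(i <- A) `|f0 i - f i| ^+ 2)).
    apply: (@cvgB R[i] C); first exact: (@cvg_cst C).
    apply: (@cvg_big C _ +%R 0 xpredT); first exact: (@add_continuous C).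
    move=> i _; rewrite expr2; apply: (@cvgM R[i]).
      apply: (@cvg_norm R[i] H); apply: (@cvgB R[i] H); [exact: cvg_cst | exact: gE].
    apply: (@cvg_norm R[i] H); apply: (@cvgB R[i] H); [exact: cvg_cst | exact: gE].
  apply: filterS Ff0 => f; rewrite -ball_normE /= => ff0.
  rewrite subr_ge0; apply: le_trans (l2_norm_ge (f0 - f) A) _.
  by rewrite ler_pXn2r ?nnegrE// ltW.
have gP : g \in l2_pred.
  have [f0 Ff0] := Fce 1 ltr01.
  have dP : (fun i => f0 i - g i) \in l2_pred.
    by apply/asboolP; exists (1 ^+ 2) => A; exact: key.
  have -> : g = (f0 : I -> H) - (fun i => f0 i - g i).
    by apply/funext => i; rewrite [RHS]subKr.
  by rewrite rpredB// l2P.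
apply: (@cvgP l2 F (L2 gP)); apply/cvgrPdist_le => e e0.
have e20 : 0 < e / 2 by rewrite divr_gt0.
have [f0 Ff0] := Fce _ e20.
have f0g : `|f0 - L2 gP| <= e / 2.
  suff : `|f0 - L2 gP| ^+ 2 <= (e / 2) ^+ 2 by rewrite ler_pXn2r ?nnegrE// ltW.
  by apply: l2_norm_le => A; exact: key.
apply: filterS Ff0 => f; rewrite -ball_normE /= => ff0.
rewrite -(subrKA f0) [leRHS]splitr.
by apply: le_trans (ler_normD _ _) _; rewrite lerD//; [rewrite distrC | exact: ltW].
Qed.

HB.instance Definition _ := Uniform_isComplete.Build l2 l2_complete.

End L2.

Arguments l2 {R} I H.
Arguments l2_pred {R I H}.

(* The product of mathcomp-analysis carries the sup norm, hence the alias. *)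
Section HilbertSum.
Variables (R : realType) (H1 H2 : hilbertType R).

Definition hsum : Type := (H1 * H2)%type.
HB.instance Definition _ := GRing.Lmodule.copy hsum (H1 * H2)%type.

Definition hsum_dot (x y : hsum) : R[i] := dot x.1 y.1 + dot x.2 y.2.

Let dot_lin (z : hsum) : scalar (hsum_dot^~ z).
Proof. by move=> a x y; rewrite /hsum_dot !dot_linear/= mulrDr addrACA. Qed.

Let dot_sym (x y : hsum) : hsum_dot x y = (hsum_dot y x)^*.
Proof. by rewrite /hsum_dot rmorphD /= -!dotC. Qed.

Let dot_pos (x : hsum) : 0 <= hsum_dot x x.
Proof. by rewrite /hsum_dot !dotxx addr_ge0// exprn_ge0. Qed.

Let dot_def (x : hsum) : hsum_dot x x = 0 -> x = 0.
Proof.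
move=> /eqP; rewrite /hsum_dot !dotxx paddr_eq0 ?exprn_ge0// !expf_eq0/= !normr_eq0.
by case: x => x1 x2 /= /andP[/eqP-> /eqP->].
Qed.

HB.instance Definition _ := Lmodule_hasDot.Build R hsum dot_lin dot_sym dot_pos dot_def.

Lemma hsum_norm (x : hsum) : `|x| ^+ 2 = `|x.1| ^+ 2 + `|x.2| ^+ 2.
Proof. by rewrite -[LHS]dotxx -!dotxx. Qed.

Let proj_cauchy (H : hilbertType R) (p : hsum -> H) (F : set_system hsum) :
  (forall x y, `|p x - p y| <= `|x - y|) ->
  ProperFilter F -> cauchy F -> cvg (p @ F).
Proof.
move=> pP FF /(cauchyP F) Fc; apply: cauchy_cvg; apply/cauchyP => e e0.
have [f0 Ff0] := Fc e e0.
exists (p f0); rewrite /nbhs /=; apply: filterS Ff0 => f.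
by rewrite -!ball_normE /=; apply: le_lt_trans.
Qed.

Let hsum_complete (F : set_system hsum) : ProperFilter F -> cauchy F -> cvg F.
Proof.
move=> FF Fc.
have p1 (x y : hsum) : `|x.1 - y.1| <= `|x - y|.
  rewrite -(@ler_pXn2r _ 2)// ?nnegrE// [leRHS]hsum_norm lerDl.
  by rewrite exprn_ge0.
have p2 (x y : hsum) : `|x.2 - y.2| <= `|x - y|.
  rewrite -(@ler_pXn2r _ 2)// ?nnegrE// [leRHS]hsum_norm lerDr.
  by rewrite exprn_ge0.
have /cvg_ex[/= a Fa] := proj_cauchy p1 FF Fc.
have /cvg_ex[/= b Fb] := proj_cauchy p2 FF Fc.
apply: (@cvgP hsum F (a, b)); apply/cvgrPdist_lt => e e0.
have e20 : 0 < e / 2 by rewrite divr_gt0.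
have ha : F [set x | `|a - x.1| < e / 2] by exact: (cvgrPdist_lt _ _).1 Fa _ e20.
have hb : F [set x | `|b - x.2| < e / 2] by exact: (cvgrPdist_lt _ _).1 Fb _ e20.
apply: filterS2 ha hb => x /= hx hy.
suff : `|((a, b) : hsum) - x| ^+ 2 < e ^+ 2 by rewrite ltr_pXn2r ?nnegrE// ltW.
rewrite [ltLHS]hsum_norm /=.
apply: lt_le_trans (_ : (e / 2) ^+ 2 + (e / 2) ^+ 2 <= _).
  by rewrite ltrD// ltr_pXn2r ?nnegrE// ltW.
rewrite -subr_ge0.
have -> : e ^+ 2 - ((e / 2) ^+ 2 + (e / 2) ^+ 2) = e ^+ 2 / 2 by field.
by rewrite divr_ge0// exprn_ge0// ltW.
Qed.

HB.instance Definition _ := Uniform_isComplete.Build hsum hsum_complete.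

End HilbertSum.

Record closed_subspace (R : realType) (H : hilbertType R) := ClosedSubspace {
  csub_set : set H;
  csub0 : csub_set 0;
  csubP : forall (a : R[i]) x y, csub_set x -> csub_set y -> csub_set (a *: x + y);
  csub_closed : closed csub_set }.

Section ClosedSubspace.
Variables (R : realType) (H : hilbertType R) (K : closed_subspace H).

Definition csub_pred : {pred H} := fun x => `[< csub_set K x >].

Record csub := CSub { csub_val : H; csub_valP : csub_val \in csub_pred }.

HB.instance Definition _ := [isSub of csub for csub_val].
HB.instance Definition _ := [Choice of csub by <:].

Let csub_submod : submod_closed csub_pred.
Proof.
split; first by apply/asboolP; exact: csub0.
by move=> a x y /asboolP Kx /asboolP Ky; apply/asboolP; exact: csubP.
Qed.

HB.instance Definition _ := GRing.isSubmodClosed.Build R[i] H csub_pred csub_submod.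
HB.instance Definition _ := [SubChoice_isSubLmodule of csub by <:].

Let cdot (x y : csub) : R[i] := dot (\val x) (\val y).

Let dot_lin (z : csub) : scalar (cdot^~ z).
Proof. by move=> a x y; rewrite /cdot linearP/= dot_linear. Qed.

Let dot_sym (x y : csub) : cdot x y = (cdot y x)^*.
Proof. exact: dotC. Qed.

Let dot_pos (x : csub) : 0 <= cdot x x.
Proof. by rewrite /cdot dotxx exprn_ge0. Qed.

Let dot_def (x : csub) : cdot x x = 0 -> x = 0.
Proof.
move=> /eqP; rewrite /cdot dotxx expf_eq0/= normr_eq0 => /eqP x0.
exact: val_inj.
Qed.

HB.instance Definition _ := Lmodule_hasDot.Build R csub dot_lin dot_sym dot_pos dot_def.

Lemma csub_norm (x : csub) : `|x| = `|\val x|.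
Proof.
by apply/eqP; rewrite -(@eqrXn2 _ 2)// -!dotxx.
Qed.

Let csub_complete (F : set_system csub) : ProperFilter F -> cauchy F -> cvg F.
Proof.
move=> FF /(cauchyP F) Fc.
have /cvg_ex[/= a Fa] : cvg ((\val x : H) @[x --> F]).
  apply: cauchy_cvg; apply/cauchyP => e e0.
  have [f0 Ff0] := Fc e e0.
  exists (\val f0); rewrite /nbhs /=; apply: filterS Ff0 => f.
  by rewrite -!ball_normE /= csub_norm raddfB.
have Ka : a \in csub_pred.
  apply/asboolP; apply: (closed_cvg (csub_set K) (@csub_closed _ _ K) _ _ Fa).
  by apply: nearW => x; apply/asboolP; exact: csub_valP.
apply: (@cvgP csub F (CSub Ka)); apply/cvgrPdist_lt => e e0.
have h : F [set x | `|a - \val x| < e] by exact: (cvgrPdist_lt _ _).1 Fa _ e0.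
by apply: filterS h => x /=; rewrite csub_norm raddfB.
Qed.

HB.instance Definition _ := Uniform_isComplete.Build csub csub_complete.

End ClosedSubspace.

Section Operators.
Variable R : realType.
Implicit Types H K : hilbertType R.

Definition bounded_op H K (T : H -> K) : Prop := linear T /\ continuous T.

Definition contractive H K (T : H -> K) : Prop := forall x, `|T x| <= `|x|.

Definition unitary H K (U : H -> K) : Prop :=
  [/\ linear U, forall x y, dot (U x) (U y) = dot x y & forall y, exists x, U x = y].

(* The adjoint; it exists, and is unique, for every bounded T. *)
Definition adj H K (T : H -> K) : K -> H :=
  xget (fun=> 0) [set S : K -> H | forall x y, dot (T x) y = dot x (S y)].

(* In the order of R[i], 0 <= z means that z is real and nonnegative. *)
Definition positive_op H (S : H -> H) : Prop :=
  bounded_op S /\ forall x, 0 <= dot (S x) x.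

(* The positive square root; it exists, and is unique, for every positive
   bounded A. The default value 0 makes it linear for an arbitrary A, so that
   the closure of its range is always a subspace. *)
Definition psqrt H (A : H -> H) : H -> H :=
  xget (fun=> 0) [set S : H -> H | positive_op S /\ S \o S = A].

Lemma psqrt_linear H (A : H -> H) : linear (psqrt A).
Proof.
rewrite /psqrt; case: xgetP => [S _ [[[SL _] _] _]|_]; first exact: SL.
by move=> a x y; rewrite scaler0 addr0.
Qed.

(* (I - T^* T)^{1/2} and (I - T T^* )^{1/2} *)
Definition defect H K (T : H -> K) : H -> H := psqrt (fun x => x - adj T (T x)).

Definition defect_star H K (T : H -> K) : K -> K := psqrt (fun y => y - T (adj T y)).

HB.instance Definition _ H K (T : H -> K) :=
  GRing.isLinear.Build R[i] H H *:%R (defect T) (@psqrt_linear H _).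
HB.instance Definition _ H K (T : H -> K) :=
  GRing.isLinear.Build R[i] K K *:%R (defect_star T) (@psqrt_linear K _).

Section ClosedRange.
Variables (H K : hilbertType R) (S : {linear H -> K}).

Let clran0 : closure (range S) 0.
Proof. by apply: subset_closure; exists 0; rewrite ?linear0. Qed.

Let clranP (a : R[i]) x y : closure (range S) x -> closure (range S) y ->
  closure (range S) (a *: x + y).
Proof.
move=> cx cy B Bxy.
have : (fun z : K * K => a *: z.1 + z.2) @ (x, y) --> a *: x + y.
  apply: (@cvgD R[i] K); last exact: cvg_snd.
  by apply: (@cvgZr R[i] K); exact: cvg_fst.
move=> /(_ _ Bxy) [[/= U V] [Ux Vy]] UVB.
have [_ [[u _ <-] Uu]] := cx _ Ux; have [_ [[v _ <-] Vv]] := cy _ Vy.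
exists (a *: S u + S v); split; first by exists (a *: u + v); rewrite ?linearP.
exact: (UVB (S u, S v)).
Qed.

Definition clran : closed_subspace K :=
  ClosedSubspace clran0 clranP (@closed_closure _ (range S)).

Lemma clran_subproof x : S x \in csub_pred clran.
Proof. by apply/asboolP; apply: subset_closure; exists x. Qed.

(* S x as an element of the closure of the range of S *)
Definition to_clran (x : H) : csub clran := CSub (clran_subproof x).

End ClosedRange.

(* The defect spaces, as Hilbert spaces in their own right *)
Definition defect_space H K (T : H -> K) : hilbertType R := csub (clran (defect T)).
Definition defect_star_space H K (T : H -> K) : hilbertType R :=
  csub (clran (defect_star T)).

(* The family f as an element of the direct sum; 0 if f is not square summable *)
Definition mkl2 (I : choiceType) H (f : I -> H) : l2 I H := insubd 0 f.

Lemma mkl2E (I : choiceType) H (f : I -> H) i : square_summable f -> mkl2 f i = f i.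
Proof. by move=> fP; rewrite [LHS](congr1 (@^~ i) (insubdK 0 _))//; apply/asboolP. Qed.

Lemma l2_square_summable (I : choiceType) H (x : l2 I H) : square_summable x.
Proof. by apply/asboolP; exact: l2P. Qed.

Lemma l2_eqP (I : choiceType) H (x y : l2 I H) : (forall i, x i = y i) -> x = y.
Proof. by move=> xy; apply/val_inj/funext. Qed.

End Operators.

Section RowContractions.
Variables (R : realType) (d : nat) (H : hilbertType R).
Implicit Types T : 'I_d -> H -> H.

Definition row_contraction T : Prop :=
  (forall i, bounded_op (T i)) /\
  forall h, dot (\sum_(i < d) T i (adj (T i) h)) h <= dot h h.

Definition rowop T (x : l2 'I_d H) : H := \sum_(i < d) T i (x i).

(* T_w = T_{w_1} o ... o T_{w_n} *)
Definition wordop T (w : seq 'I_d) : H -> H := foldr (fun i S => T i \o S) id w.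

End RowContractions.

(* Gamma (x) H, where Gamma is the full Fock space over C^d: Gamma has the
   orthonormal basis (e_w) indexed by words, so that Gamma (x) H is the
   orthogonal sum of the e_w (x) H. An element x of Gamma (x) H is given by its
   coordinates, x = sum_w e_w (x) x w. *)
Definition fock (R : realType) (d : nat) (H : hilbertType R) : hilbertType R :=
  l2 (seq 'I_d) H.

Section Fock.
Variables (R : realType) (d : nat).
Implicit Types (H K : hilbertType R) (w : seq 'I_d) (i : 'I_d).

(* e_w (x) h; dot_etens below shows that these vectors span a dense subspace and
   that <e_v (x) g, e_w (x) h> = <e_v, e_w> <g, h>. *)
Definition etens H w (h : H) : fock d H := mkl2 (fun v => if v == w then h else 0).

Lemma etensE H w (h : H) v : etens w h v = if v == w then h else 0.
Proof.
apply: mkl2E; exists (`|h| ^+ 2) => A.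
have h0 : 0 <= `|h| ^+ 2 :> R[i] by rewrite exprn_ge0.
have [wA|wA] := boolP (w \in A).
  rewrite (big_fsetD1 w)//= eqxx big1_fset ?addr0// => u.
  by rewrite !inE => /andP[/negPf-> _] _; rewrite normr0 expr0n.
rewrite big1_fset// => u uA _; case: eqP => [uw|_]; last by rewrite normr0 expr0n.
by rewrite -uw uA in wA.
Qed.

Lemma dot_etens H (x : fock d H) w (h : H) : dot x (etens w h) = dot (x w) h.
Proof.
apply: l2_dotE.
have H0 : (fun=> dot (x w) h : R[i]^o) @ @totally (seq 'I_d) --> (dot (x w) h : R[i]^o).
  exact: (@cvg_cst R[i]^o).
refine (cvg_trans _ H0); apply: near_eq_cvg.
suff : totally [set A : {fset seq 'I_d} |
  dot (x w) h = partial_sum (fun v => dot (x v) (etens w h v) : R[i]^o) A] by [].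
exists [fset w]%fset => // A /= wA.
have {}wA : w \in A by rewrite (fsubsetP wA)// inE.
rewrite [RHS](@partial_sumE R) (big_fsetD1 w)//= etensE eqxx big1_fset ?addr0// => u.
by rewrite !inE etensE => /andP[/negPf-> _] _; rewrite dot0r.
Qed.

(* e_0 (x) h *)
Definition vac H (h : H) : fock d H := etens [::] h.

(* L_i (x) I *)
Definition creation H i (x : fock d H) : fock d H :=
  mkl2 (fun w => if w is j :: v then (if j == i then x v else 0) else 0).

Lemma creationE H i (x : fock d H) w :
  creation i x w = if w is j :: v then (if j == i then x v else 0) else 0.
Proof.
apply: mkl2E; exists (`|x| ^+ 2) => A.
pose B := [fset behead w | w in [fset w in A | ohead w == Some i]]%fset.
apply: le_trans (l2_norm_ge x B).
rewrite /B big_imfset /=; last first.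
  move=> [|a u] [|b v]; rewrite !inE/= ?andbF// => /andP[_ /eqP[->]] /andP[_ /eqP[->]].
  by move=> ->.
rewrite big_fset /= [leRHS]big_mkcond/=; apply: ler_sum => -[|j v] _ /=.
  by rewrite normr0 expr0n.
by rewrite (inj_eq Some_inj); case: (j == i); rewrite ?normr0 ?expr0n.
Qed.

Lemma creation_etens H i w (h : H) : creation i (etens w h) = etens (i :: w) h.
Proof.
apply: l2_eqP => -[|j v]; rewrite creationE etensE// etensE eqseq_cons.
by case: (j == i).
Qed.

(* I (x) g; well defined for bounded g, see ampliationE for contractions *)
Definition ampliation H K (g : H -> K) (x : fock d H) : fock d K :=
  mkl2 (fun w => g (x w)).

Lemma ampliationE H K (g : H -> K) (x : fock d H) w :
  contractive g -> ampliation g x w = g (x w).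
Proof.
move=> gC; apply: mkl2E; exists (`|x| ^+ 2) => A.
apply: le_trans (l2_norm_ge x A); apply: ler_sum => v _.
by rewrite ler_pXn2r ?nnegrE.
Qed.

Definition multi_analytic H K (M : fock d H -> fock d K) : Prop :=
  bounded_op M /\ forall i x, M (creation i x) = creation i (M x).

Definition symbol H K (M : fock d H -> fock d K) : H -> fock d K := fun h => M (vac h).

(* M_theta, the multi-analytic operator with symbol theta, if there is one *)
Definition multop H K (theta : H -> fock d K) : fock d H -> fock d K :=
  xget (fun=> 0) [set M | multi_analytic M /\ symbol M = theta].

(* The orthogonal projection onto e_0 (x) H *)
Definition vacproj H (x : fock d H) : fock d H := vac (x [::]).

Definition purely_contractive H K (M : fock d H -> fock d K) : Prop :=
  forall h, h != 0 -> `|vacproj (symbol M h)| < `|h|.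

(* The condition on x says that x is orthogonal to e_0 (x) H. *)
Definition szego H K (M : fock d H -> fock d K) : Prop :=
  closure (range (defect M)) =
  closure (defect M @` [set x | forall h, dot x (vac h) = 0]).

Variable H : hilbertType R.
Implicit Types A : 'I_d -> H -> H.

(* The characteristic function theta_A. The word k :: v is the basis vector
   e_k (x) e_v. For x in D_A the vector A x lies in D_{*,A}, and insubd only
   records this membership; likewise the family is square summable for every
   row contraction A. *)
Definition charfun A (x : defect_space (rowop A)) : fock d (defect_star_space (rowop A)) :=
  mkl2 (fun w => match w return defect_star_space (rowop A) with
    | [::] => - insubd 0 (rowop A (csub_val x))
    | k :: v => to_clran (defect_star (rowop A))
                  (adj (wordop A v) (defect (rowop A) (csub_val x) k))
    end).

(* M_{theta_A} *)
Definition charop A : fock d (defect_space (rowop A)) ->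
    fock d (defect_star_space (rowop A)) := multop (@charfun A).

Definition resolving A K (gamma : defect_star_space (rowop A) -> K) : Prop :=
  forall h : H,
    (forall w, gamma (to_clran (defect_star (rowop A)) (adj (wordop A w) h)) = 0) ->
    forall w, defect_star (rowop A) (adj (wordop A w) h) = 0.

(* [D_{*,gamma}  (I (x) gamma) theta_A] *)
Definition rowsymbol A K (gamma : defect_star_space (rowop A) -> K)
    (y : hsum (defect_star_space gamma) (defect_space (rowop A))) : fock d K :=
  vac (defect_star gamma (csub_val y.1)) + ampliation gamma (charfun y.2).

End Fock.

Arguments charfun {R d H} A x.
Arguments charop {R d H} A.
Arguments resolving {R d H A K} gamma.
Arguments rowsymbol {R d H A K} gamma y.

(* Main.v *)
From HB Require Import structures.
Require Import Defs.
From mathcomp Require Import all_boot all_order all_algebra.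
From mathcomp Require Import boolp classical_sets reals topology normedtype.
From mathcomp Require Import complex ring finmap.
From mathcomp.analysis.showcase Require Import summability.
Set Implicit Arguments.
Unset Strict Implicit.
Unset Printing Implicit Defensive.
Import Order.TTheory GRing.Theory Num.Theory.
Import numFieldNormedType.Exports.
Local Open Scope classical_set_scope.
Local Open Scope ring_scope.

(** For (i), let Delta_* = (I - M M^* )^{1/2}. On H = cl ran Delta_* there is an
    isometric colligation [[e, A], [f, b]] : L + H^d -> H + D with
      e l = Delta_* (e_0 (x) l),        A_i (Delta_* a) = Delta_* (L_i a),
      f l = (M^* (e_0 (x) l))(empty),   b_i (Delta_* a) = (M^* (L_i a))(empty),
    where (empty) is the coordinate at the empty word. Its transfer function is
    the symbol: theta x = f^* x at the empty word and e^* A_v^* b_k^* x at kv.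
    The isometry gives |e^* h| <= |D_{*,A} h| and |b x| = |D_A x|, hence a
    contraction gamma with gamma D_{*,A} = e^* and an isometry tau of D_A into D
    with tau D_A = b; the complement of its range is identified with the defect
    space of gamma^* by means of the vectors f l + tau A^* gamma^* l.
    The pair (e^*, A^* ) is observable because Delta_* is injective on H, so
    gamma is resolving, and M_{theta_A} satisfies the Szego condition: with the
    Poisson kernel K h = (D_{*,A} A_w^* h)_w one has M M^* + K K^* = I, so that
    Delta z = e_0 (x) u gives theta_A u = M Delta z = Delta_* M z in ran K,
    which forces u = 0.

    For (ii), if (p, y) is in the kernel, then resolvability gives
    theta_A y = - e_0 (x) A y, so Delta (e_0 (x) y) is orthogonal to the image
    under Delta of the complement of e_0 (x) D_A. By the Szego condition it
    vanishes, and pure contractivity yields y = 0. Contractivity of M_theta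
    holds because [D_{*,gamma} gamma] is a coisometry. *)

(** * Operators on Hilbert spaces *)

Section LinearFunctions.
Variables (R : realType) (X Y : lmodType R[i]) (T : X -> Y).
Hypothesis lT : linear T.

Lemma linD x y : T (x + y) = T x + T y.
Proof. by have := lT 1 x y; rewrite !scale1r. Qed.

Lemma lin0 : T 0 = 0.
Proof. by apply: (addrI (T 0)); rewrite -linD !addr0. Qed.

Lemma linZ a x : T (a *: x) = a *: T x.
Proof. by have := lT a x 0; rewrite lin0 !addr0. Qed.

Lemma linN x : T (- x) = - T x.
Proof. by rewrite -scaleN1r linZ scaleN1r. Qed.

Lemma linB x y : T (x - y) = T x - T y.
Proof. by rewrite linD linN. Qed.

Lemma lin_sum (I : Type) (r : seq I) (P : pred I) (F : I -> X) :
  T (\sum_(i <- r | P i) F i) = \sum_(i <- r | P i) T (F i).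
Proof.
elim: r => [|i r IH]; first by rewrite !big_nil lin0.
by rewrite !big_cons; case: (P i); rewrite ?linD IH.
Qed.

End LinearFunctions.

Section Dot.
Variable (R : realType) (H : preHilbertType R).
Implicit Types x y z : H.

Lemma dotNl x y : dot (- x) y = - dot x y.
Proof. by rewrite -scaleN1r dotZl mulN1r. Qed.

Lemma dotNr x y : dot x (- y) = - dot x y.
Proof. by rewrite dotC dotNl rmorphN /= -dotC. Qed.

Lemma dotBl x y z : dot (x - y) z = dot x z - dot y z.
Proof. by rewrite dotDl dotNl. Qed.

Lemma dotBr x y z : dot x (y - z) = dot x y - dot x z.
Proof. by rewrite dotDr dotNr. Qed.

Lemma dot_sumr (I : Type) (r : seq I) (P : pred I) (F : I -> H) y :
  dot y (\sum_(i <- r | P i) F i) = \sum_(i <- r | P i) dot y (F i).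
Proof.
elim: r => [|i r IH]; first by rewrite !big_nil dot0r.
by rewrite !big_cons; case: (P i); rewrite ?dotDr IH.
Qed.

Lemma dotxx_ge0 x : 0 <= dot x x.
Proof. by rewrite dotxx exprn_ge0. Qed.

Lemma dotxx_eq0 x : dot x x = 0 -> x = 0.
Proof. by move=> /eqP; rewrite dotxx expf_eq0/= normr_eq0 => /eqP. Qed.

Lemma dotr_inj x y : (forall z, dot x z = dot y z) -> x = y.
Proof. by move=> xy; apply/subr0_eq/dotxx_eq0; rewrite dotBl xy subrr. Qed.

Lemma dotl_inj x y : (forall z, dot z x = dot z y) -> x = y.
Proof. by move=> xy; apply: dotr_inj => z; rewrite dotC xy -dotC. Qed.

Lemma sqr_normD x y : `|x + y| ^+ 2 = `|x| ^+ 2 + `|y| ^+ 2 + (dot x y + (dot x y)^*).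
Proof. by rewrite -!dotxx dotDl !dotDr -(dotC y x); ring. Qed.

Lemma parallelogram x y :
  `|x + y| ^+ 2 + `|x - y| ^+ 2 = `|x| ^+ 2 *+ 2 + `|y| ^+ 2 *+ 2.
Proof. by rewrite -!dotxx !(dotDl, dotDr, dotNl, dotNr); ring. Qed.

Lemma norm_le_dot x c : 0 <= c -> dot x x <= c * `|x| -> `|x| <= c.
Proof.
move=> c0; have [->|x0] := eqVneq x 0; first by rewrite normr0.
by rewrite dotxx expr2 ler_pM2r// normr_gt0.
Qed.

End Dot.

Lemma sqr_norm_le (R : realType) (H K : preHilbertType R) (x : H) (y : K) :
  (`|x| ^+ 2 <= `|y| ^+ 2) = (`|x| <= `|y|).
Proof. by rewrite ler_pXn2r ?nnegrE. Qed.

Lemma sqr_norm_eq (R : realType) (H K : preHilbertType R) (x : H) (y : K) :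
  `|x| ^+ 2 = `|y| ^+ 2 -> `|x| = `|y|.
Proof. by move=> xy; apply/le_anti; rewrite -!sqr_norm_le xy lexx. Qed.

(** * Convergence with the explicit rate 1/(n+1) *)

Section SlowCauchy.
Variable R : realType.

(** Positivity in [R[i]] includes being real, so the Archimedean property of [R] applies to the real
    part. *)
Lemma complex_archi (e : R[i]) : 0 < e -> exists n : nat, n.+1%:R^-1 < e.
Proof.
move=> e0.
have eE : e = (complex.Re e)%:C%C by rewrite RRe_real// gtr0_real.
have e0' : 0 < complex.Re e by rewrite -ltcR -eE.
have i0 : 0 <= (complex.Re e)^-1 by rewrite invr_ge0 ltW.
exists (Num.Def.archi_bound (complex.Re e)^-1).
have h : (complex.Re e)^-1 < (Num.Def.archi_bound (complex.Re e)^-1).+1%:R.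
  by apply: lt_le_trans (archi_boundP i0) _; rewrite ler_nat.
have h2 : ((Num.Def.archi_bound (complex.Re e)^-1).+1%:R)^-1 < complex.Re e.
  by rewrite invf_plt// posrE// ltr0n.
rewrite eE; move: h2; rewrite -ltcR fmorphV/= rmorph_nat.
by [].
Qed.

Lemma le_inv_nat_eq0 (a c : R[i]) :
  0 <= a -> 0 <= c -> (forall n : nat, a <= c * n.+1%:R^-1) -> a = 0.
Proof.
move=> a0 c0 h; apply/eqP/negPn/negP => an0.
have {an0} a_gt0 : 0 < a by rewrite lt_def an0.
have c_gt0 : 0 < c.
  rewrite lt_def c0 andbT; apply/eqP => c00.
  by have := h 0%N; rewrite c00 mul0r => /(lt_le_trans a_gt0); rewrite ltxx.
have [n] := complex_archi (divr_gt0 a_gt0 c_gt0).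
rewrite ltr_pdivlMr// mulrC => /(le_lt_trans (h n)).
by rewrite ltxx.
Qed.

(** Minimising sequences and the iterates for the square root are Cauchy at this rate; keeping it in
    the conclusion lets later estimates avoid filters. *)
Lemma inv_nat_cvg (H : hilbertType R) (u : nat -> H) (c : R[i]) : 0 <= c ->
  (forall m n, (n <= m)%N -> `|u m - u n| <= c * n.+1%:R^-1) ->
  exists l, forall n, `|l - u n| <= c * n.+1%:R^-1.
Proof.
move=> c0 uc.
have /cvg_ex[/= l ul] : cvg (u @ \oo).
  apply: cauchy_cvg; apply/cauchyP => e e0.
  have c1 : 0 < c + 1 by rewrite ltr_wpDl.
  have [N hN] := complex_archi (divr_gt0 e0 c1).
  exists (u N); exists N => // m /= Nm.
  rewrite -ball_normE /= distrC; apply: le_lt_trans (uc _ _ Nm) _.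
  move: hN; rewrite ltr_pdivlMr//; apply: le_lt_trans.
  by rewrite mulrC ler_wpM2l ?invr_ge0 ?ler0n ?lerDl.
exists l => n.
have nc : (fun m => l - u n : H) @ \oo --> l - u n by exact: cvg_cst.
rewrite -subr_ge0.
apply: (@lim_ge0 R nat \oo (fun m => c * n.+1%:R^-1 - `|u m - u n|)).
  apply: (@cvgB R[i] R[i]^o); first exact: (@cvg_cst R[i]^o).
  by apply: (@cvg_norm R[i] H); apply: (@cvgB R[i] H) => //; exact: cvg_cst.
by exists n => // m /= nm; rewrite subr_ge0 uc.
Qed.

End SlowCauchy.

(** * Riesz representation on the closure of a range *)

Section Riesz.
Variable R : realType.

Lemma add_conj_le (a : R[i]) : a + a^* <= `|a| *+ 2.
Proof.
rewrite -[leRHS]mulr_natr -ler_pdivrMr// -ReE.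
exact: (leif_Re_Creal a).
Qed.

Lemma add_conj_real (a : R[i]) : a + a^* \is Num.real.
Proof. by apply/CrealP; rewrite rmorphD /= conjCK addrC. Qed.

Lemma closure_seq (Z : hilbertType R) (A : set Z) z :
  (forall n : nat, exists2 x, A x & `|z - x| <= n.+1%:R^-1) -> closure A z.
Proof.
move=> h B /nbhs_ballP[e /= e0 eB].
have [n ne] := complex_archi e0; have [x Ax xz] := h n.
exists x; split => //; apply: eB; rewrite -ball_normE /=.
exact: le_lt_trans ne.
Qed.

(* The minimiser of |T x|^2 - 2 Re (f x) over the closure of the range of T
   represents f. With T = id this is Riesz' theorem, with f = <T x, y> it is
   the orthogonal projection onto the closure of the range. *)
Lemma riesz_range (X : lmodType R[i]) (Z : hilbertType R) (T : X -> Z)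
    (f : X -> R[i]) (c : R[i]) : linear T -> scalar f -> 0 <= c ->
  (forall x, `|f x| <= c * `|T x|) ->
  exists2 z, closure (range T) z & forall x, f x = dot (T x) z.
Proof.
move=> lT lf c0 fc.
have fD x y : f (x + y) = f x + f y by have := lf 1 x y; rewrite scale1r mul1r.
have f0 : f 0 = 0 by apply: (addrI (f 0)); rewrite -fD !addr0.
have fZ a x : f (a *: x) = a * f x by have := lf a x 0; rewrite f0 !addr0.
pose E x : R[i] := `|T x| ^+ 2 - (f x + (f x)^*).
have Ereal x : E x \is Num.real by rewrite rpredB ?add_conj_real ?rpredX ?ger0_real.
(* Completing the square with (|T x| - c)^2 >= 0. *)
have Elow x : - c ^+ 2 <= E x.
  rewrite -subr_ge0 opprK /E.
  have h : f x + (f x)^* <= (c * `|T x|) *+ 2.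
    by apply: le_trans (add_conj_le _) _; rewrite lerMn2r fc orbT.
  apply: (@le_trans _ _ (`|T x| ^+ 2 - (c * `|T x|) *+ 2 + c ^+ 2)).
    have -> : `|T x| ^+ 2 - (c * `|T x|) *+ 2 + c ^+ 2 = (`|T x| - c) ^+ 2 by ring.
    by apply: real_exprn_even_ge0 => //; rewrite rpredB ?ger0_real.
  by rewrite lerD2r lerD2l lerN2.
pose S := range (fun x => complex.Re (E x)).
have EC x : (complex.Re (E x))%:C%C = E x by rewrite RRe_real.
have Sinf : has_inf S.
  split; first by exists (complex.Re (E 0)), 0.
  exists (complex.Re (- c ^+ 2)) => _ [x _ <-].
  by have := Elow x; rewrite lecE => /andP[].
pose m := (inf S)%:C%C.
have mE x : m <= E x.
  by rewrite -EC lecR; apply: ge_inf; [case: Sinf | exists x].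
pose eps (n : nat) : R[i] := n.+1%:R^-1.
have eps0 n : 0 <= eps n by rewrite invr_ge0 ler0n.
(* The tolerance eps^2/4 is what the parallelogram law turns into the bound [eps n] on |T (u p) - T
   (u n)|. *)
have Eeps n : exists x, E x <= m + eps n ^+ 2 / 4%:R.
  have e0 : 0 < (n.+1%:R^-1 ^+ 2 / 4%:R : R) by rewrite divr_gt0 ?exprn_gt0 ?invr_gt0 ?ltr0n.
  have [_ [x _ <-] xe] := inf_adherent e0 Sinf.
  exists x; apply: ltW; rewrite -EC.
  have -> : m + eps n ^+ 2 / 4%:R = (inf S + n.+1%:R^-1 ^+ 2 / 4%:R)%:C%C.
    by rewrite rmorphD rmorphM/= rmorphXn/= !fmorphV/= !rmorph_nat.
  by rewrite ltcR.
have [u uE] : {u : nat -> X | forall n, E (u n) <= m + eps n ^+ 2 / 4%:R}.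
  by exists (fun n => sval (cid (Eeps n))) => n; exact: (svalP (cid (Eeps n))).
have ucauchy p n : (n <= p)%N -> `|T (u p) - T (u n)| <= 1 * eps n.
  move=> np; rewrite mul1r -(@ler_pXn2r _ 2)// ?nnegrE//.
  (* The linear part of [E] cancels in the parallelogram law, leaving the value of [E] at the
     midpoint, which is at least [m]. *)
  have -> : `|T (u p) - T (u n)| ^+ 2 =
     E (u p) *+ 2 + E (u n) *+ 2 - E (2%:R^-1 *: (u p + u n)) *+ 4.
    have := parallelogram (T (u p)) (T (u n)) => /(congr1 (fun t => t - `|T (u p) + T (u n)| ^+ 2)).
    rewrite addrC addrA addNr add0r => ->.
    rewrite /E (linZ lT) (linD lT) fZ fD normrZ exprMn.
    rewrite rmorphM rmorphD /= ger0_norm ?invr_ge0 ?ler0n// fmorphV /= rmorph_nat.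
    by field.
  apply: (@le_trans _ _ ((m + eps p ^+ 2 / 4%:R) *+ 2 + (m + eps n ^+ 2 / 4%:R) *+ 2 - m *+ 4)).
    by apply: lerD; first apply: lerD; rewrite ?lerN2 lerMn2r ?uE ?mE.
  have -> : (m + eps p ^+ 2 / 4%:R) *+ 2 + (m + eps n ^+ 2 / 4%:R) *+ 2 - m *+ 4
    = (eps p ^+ 2 + eps n ^+ 2) / 2%:R by field.
  rewrite ler_pdivrMr ?ltr0n// mulr_natr mulr2n lerD2r.
  rewrite ler_pXn2r ?nnegrE//.
  by rewrite lef_pV2 ?posrE ?ltr0n// ler_nat.
have [z zu] := inv_nat_cvg ler01 ucauchy.
exists z.
  apply: closure_seq => n; exists (T (u n)); first by exists (u n).
  by have := zu n; rewrite mul1r.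
move=> x; apply/eqP; rewrite -subr_eq0 -normr_eq0; apply/eqP.
(* The summand 1 keeps the denominator of the step length positive when T x = 0. *)
pose s := 1 + `|T x| ^+ 2.
have s1 : 1 <= s by rewrite lerDl exprn_ge0.
have s0 : 0 < s by apply: lt_le_trans s1.
apply: (@le_inv_nat_eq0 _ _ (s + `|T x|)) => // [|n].
  by rewrite addr_ge0 ?normr_ge0// ltW.
have [g gE] : exists g : R[i], g = f x - dot (T x) (T (u n)) by eexists.
(* [E] is at least [m] at the perturbed point u n + (g^*/s) x; as |T x|^2 <= s, near minimality of
   [u n] bounds the residual [g]. *)
have gs : `|g| ^+ 2 <= s * (eps n ^+ 2 / 4%:R).
  have := le_trans (mE (u n + (g^* / s) *: x)) _.
  have -> : E (u n + (g^* / s) *: x) =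
      E (u n) + (`|g| ^+ 2 / s ^+ 2 * `|T x| ^+ 2 - (`|g| ^+ 2 / s) *+ 2).
    rewrite /E (linD lT) (linZ lT) fD fZ sqr_normD dotZr normrZ.
    have sr : s^* = s by apply/CrealP/ger0_real/ltW.
    have xx : dot (T (u n)) (T x) = (f x - g)^* by rewrite gE opprB addrC subrK -dotC.
    rewrite exprMn normrM normfV norm_conjC (ger0_norm (ltW s0)) expr_div_n.
    rewrite normCK.
    have gc : (g^* / s)^* = g / s by rewrite rmorphM /= fmorphV /= conjCK sr.
    have c1 : (g / s * (f x - g)^*)^* = g^* / s * (f x - g).
      by rewrite !rmorphM /= fmorphV /= conjCK sr.
    have c2 : (f (u n) + g^* / s * f x)^* = (f (u n))^* + g / s * (f x)^*.
      by rewrite rmorphD rmorphM /= gc.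
    rewrite xx gc c1 c2 rmorphB /=.
    set a := f x; set b := a^*; set h := g^*.
    have s_neq0 : s != 0 by rewrite gt_eqF.
    by field.
  move=> /(_ _ (lerD (uE n) (lexx _))).
  rewrite -subr_ge0 => h.
  rewrite -subr_ge0; apply: le_trans (mulr_ge0 (ltW s0) h) _.
  rewrite -subr_ge0.
  have -> : s * (eps n ^+ 2 / 4%:R) - `|g| ^+ 2 - s * (m + eps n ^+ 2 / 4%:R +
     (`|g| ^+ 2 / s ^+ 2 * `|T x| ^+ 2 - `|g| ^+ 2 / s *+ 2) - m) =
     `|g| ^+ 2 * (s - `|T x| ^+ 2) / s.
    have s_neq0 : s != 0 by rewrite gt_eqF.
    by field.
  by rewrite /s addrK mulr1 divr_ge0 ?exprn_ge0 ?normr_ge0// ltW.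
have -> : f x - dot (T x) z = g - dot (T x) (z - T (u n)).
  by rewrite gE dotBr; ring.
apply: le_trans (ler_normB _ _) _; rewrite mulrDl lerD//.
  rewrite -(@ler_pXn2r _ 2)// ?nnegrE ?normr_ge0 ?mulr_ge0 ?eps0 ?(ltW s0)//.
  apply: le_trans gs _; rewrite -/(eps n).
  have -> : (s * eps n) ^+ 2 = s * (s * eps n ^+ 2) by ring.
  apply: ler_wpM2l; first exact: ltW.
  have e2 : 0 <= eps n ^+ 2 by rewrite exprn_ge0.
  apply: le_trans (_ : eps n ^+ 2 <= _).
    by rewrite ler_pdivrMr ?ltr0n// mulr_natr mulrS lerDl mulrn_wge0.
  by rewrite -[leLHS]mul1r ler_wpM2r.
apply: le_trans (Defs.CauchySchwarz _ _) _; rewrite ler_wpM2l ?normr_ge0//.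
by have := zu n; rewrite mul1r.
Qed.

End Riesz.

(** * Bounded operators, adjoints and factorization *)

Section BoundedOperators.
Variable R : realType.
Implicit Types H K L : hilbertType R.

(** Trades continuity for a norm bound, the form in which closure under composition, sums and
    adjoints is checked. *)
Lemma bounded_opP H K (T : H -> K) :
  bounded_op T <-> linear T /\ exists2 c, 0 <= c & forall x, `|T x| <= c * `|x|.
Proof.
split=> [[lT cT]|[lT [c c0 Tc]]]; split => //.
  pose lTm := GRing.isLinear.Build R[i] H K *:%R T lT.
  pose TL : {linear H -> K} := HB.pack T lTm.
  have : bounded_near TL (nbhs (0 : H)).
    by apply: (continuous_linear_bounded 0 (f := TL)); exact: cT.
  move=> /linear_boundedP [M [Mr hM]].
  exists (`|M| + 1); first by rewrite addr_ge0.
  by apply: hM; apply: le_lt_trans (real_ler_norm Mr) _; rewrite ltrDl.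
move=> x; apply/cvgrPdist_lt => e e0.
have c1 : 0 < c + 1 by rewrite ltr_wpDl.
near=> y.
rewrite -(linB lT); apply: le_lt_trans (Tc _) _.
apply: (@le_lt_trans _ _ ((c + 1) * `|x - y|)).
  by rewrite ler_wpM2r// lerDl.
rewrite mulrC -ltr_pdivlMr//.
near: y; apply: (cvgrPdist_lt _ _).1; first exact: cvg_id.
by rewrite divr_gt0.
Unshelve. all: by end_near. Qed.

Lemma bounded_op_linear H K (T : H -> K) : bounded_op T -> linear T.
Proof. by case. Qed.

Lemma contractive_bounded H K (T : H -> K) : linear T -> contractive T -> bounded_op T.
Proof. by move=> lT cT; apply/bounded_opP; split=> //; exists 1 => // x; rewrite mul1r. Qed.

Lemma bounded_op_id H : bounded_op (id : H -> H).
Proof. exact: contractive_bounded. Qed.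

Lemma bounded_op_comp H K L (S : K -> L) (T : H -> K) :
  bounded_op S -> bounded_op T -> bounded_op (S \o T).
Proof.
move=> /bounded_opP[lS [c c0 Sc]] /bounded_opP[lT [b b0 Tb]]; apply/bounded_opP; split.
  by move=> a x y /=; rewrite lT lS.
exists (c * b) => [|x]; first exact: mulr_ge0.
by apply: le_trans (Sc _) _; rewrite -mulrA; apply: ler_wpM2l.
Qed.

Lemma bounded_opD H K (S T : H -> K) :
  bounded_op S -> bounded_op T -> bounded_op (fun x => S x + T x).
Proof.
move=> /bounded_opP[lS [c c0 Sc]] /bounded_opP[lT [b b0 Tb]]; apply/bounded_opP; split.
  by move=> a x y /=; rewrite lT lS scalerDr addrACA.
exists (c + b) => [|x]; first exact: addr_ge0.
by apply: le_trans (ler_normD _ _) _; rewrite mulrDl lerD.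
Qed.

Lemma bounded_opN H K (T : H -> K) : bounded_op T -> bounded_op (fun x => - T x).
Proof.
move=> /bounded_opP[lT [b b0 Tb]]; apply/bounded_opP; split.
  by move=> a x y /=; rewrite lT opprD scalerN.
by exists b => // x; rewrite normrN.
Qed.

Lemma linear_dot H K (T : H -> K) y : linear T -> scalar (fun x => dot (T x) y).
Proof. by move=> lT a x z; rewrite lT dotDl dotZl. Qed.

(** Riesz' theorem, [riesz_range] with the identity as [T], applied to x |-> <T x, y>, shows that
    [xget] has a candidate to choose. *)
Lemma adjE H K (T : H -> K) : bounded_op T -> forall x y, dot (T x) y = dot x (adj T y).
Proof.
move=> /bounded_opP[lT [c c0 Tc]].
suff [S TS] : exists S : K -> H, forall x y, dot (T x) y = dot x (S y).
  by rewrite /adj; case: xgetP => [S' _ //|/(_ S)]; case.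
have h y : exists z, forall x, dot (T x) y = dot x z.
  have [||x|z _ hz] := @riesz_range R H H id _ (c * `|y|) _ (linear_dot y lT).
  - by [].
  - by rewrite mulr_ge0.
  - apply: le_trans (Defs.CauchySchwarz _ _) _.
    by rewrite mulrAC; apply: ler_wpM2r.
  by exists z.
by exists (fun y => sval (cid (h y))) => x y; exact: (svalP (cid (h y))).
Qed.

Section Adjoint.
Variables (H K : hilbertType R) (T : H -> K).
Hypothesis bT : bounded_op T.

Lemma adjEl x y : dot (adj T y) x = dot y (T x).
Proof. by rewrite dotC -(adjE bT) -dotC. Qed.

Lemma adj_unique y z : (forall x, dot (T x) y = dot x z) -> adj T y = z.
Proof. by move=> h; apply: dotl_inj => x; rewrite -(adjE bT). Qed.

Lemma adj_linear : linear (adj T).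
Proof.
move=> a x y; apply: dotr_inj => z.
by rewrite dotDl dotZl !adjEl dotDl dotZl.
Qed.

Lemma adj_bound c : 0 <= c -> (forall x, `|T x| <= c * `|x|) ->
  forall y, `|adj T y| <= c * `|y|.
Proof.
move=> c0 Tc y; apply: norm_le_dot; first by rewrite mulr_ge0.
rewrite -(adjE bT).
have h : `|dot (T (adj T y)) y| <= c * `|y| * `|adj T y|.
  apply: le_trans (Defs.CauchySchwarz _ _) _.
  by rewrite mulrAC; apply: ler_wpM2r.
(* The inner product is real since it equals <T^* y, T^* y>; comparing it with its modulus requires
   this. *)
apply: le_trans h; rewrite real_ler_norm//.
by rewrite (adjE bT) ger0_real ?dotxx_ge0.
Qed.

Lemma adj_bounded : bounded_op (adj T).
Proof.
have /bounded_opP[_ [c c0 Tc]] := bT.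
by apply/bounded_opP; split; [exact: adj_linear | exists c => //; exact: adj_bound].
Qed.

Lemma adj_contractive : contractive T -> contractive (adj T).
Proof.
move=> cT y; rewrite -[leRHS]mul1r; apply: adj_bound => // x.
by rewrite mul1r.
Qed.

Lemma adjK : adj (adj T) = T.
Proof.
by apply/funext => x; apply: dotl_inj => y; rewrite -(adjE adj_bounded) adjEl.
Qed.

End Adjoint.

Lemma adj_comp H K L (S : K -> L) (T : H -> K) y :
  bounded_op S -> bounded_op T -> adj (S \o T) y = adj T (adj S y).
Proof.
move=> bS bT; apply: adj_unique; first exact: bounded_op_comp.
by move=> x; rewrite -(adjE bT) -(adjE bS).
Qed.

Lemma adj_id H : adj (id : H -> H) = id.
Proof. by apply/funext => y; apply: adj_unique => //; exact: bounded_op_id. Qed.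

Lemma closure_normP H (A : set H) z :
  closure A z <-> forall e, 0 < e -> exists2 x, A x & `|z - x| < e.
Proof.
split=> [cz e e0|h].
  have [x [Ax xz]] := cz _ (nbhsx_ballx z e e0).
  by exists x => //; move: xz; rewrite -ball_normE.
apply: closure_seq => n.
have [|x Ax /ltW xz] := h n.+1%:R^-1; first by rewrite invr_gt0 ltr0n.
by exists x.
Qed.

Lemma closure_orth H (A : set H) y z :
  (forall x, A x -> dot x y = 0) -> closure A z -> dot z y = 0.
Proof.
move=> Ay /closure_normP cz; apply/eqP; rewrite -normr_eq0; apply/eqP.
apply: (@le_inv_nat_eq0 _ _ `|y|) => // n.
have [|x Ax /ltW xz] := cz n.+1%:R^-1; first by rewrite invr_gt0 ltr0n.
rewrite -[z](subrK x) dotDl (Ay x Ax) addr0; apply: le_trans (Defs.CauchySchwarz _ _) _.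
by rewrite mulrC; apply: ler_wpM2l.
Qed.

(** The closure of the range is its double orthogonal complement. For the converse, [riesz_range]
    gives the projection p of z onto the closure; z - p is orthogonal to the range, hence to both z
    and p. *)
Lemma closure_rangeP (X : lmodType R[i]) H (T : X -> H) z : linear T ->
  closure (range T) z <-> forall y, (forall x, dot (T x) y = 0) -> dot z y = 0.
Proof.
move=> lT; split=> [cz y Ty|h]; first by apply: closure_orth _ cz => _ [x _ <-].
have ls : scalar (fun x => dot (T x) z).
  by move=> a x y; rewrite lT dotDl dotZl.
have [|x|p cp hp] := riesz_range lT ls (c := `|z|); first by [].
  by rewrite mulrC; exact: Defs.CauchySchwarz.
have o x : dot (T x) (z - p) = 0 by rewrite dotBr hp subrr.
suff -> : z = p by [].
apply/subr0_eq/dotxx_eq0; rewrite {1}dotBl h// sub0r.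
by rewrite (closure_orth _ cp) ?oppr0// => _ [x _ <-].
Qed.

(** Douglas' lemma. The adjoint V of W is built first: the functional x |-> <S x, y> is dominated by
    |y| |T x|, so [riesz_range] represents it by a vector V y in the closure of the range of [T]. *)
Lemma douglas_factor (X : lmodType R[i]) H K (T : X -> H) (S : X -> K) :
  linear T -> linear S -> (forall x, `|S x| <= `|T x|) ->
  exists W : H -> K, [/\ linear W, contractive W & forall x, W (T x) = S x].
Proof.
move=> lT lS ST.
have h y : exists z, closure (range T) z /\ forall x, dot (S x) y = dot (T x) z.
  have ls : scalar (fun x => dot (S x) y) by move=> a u v; rewrite lS dotDl dotZl.
  have [|x|z cz hz] := riesz_range lT ls (c := `|y|); first by [].
    apply: le_trans (Defs.CauchySchwarz _ _) _.
    by rewrite mulrC; apply: ler_wpM2l.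
  by exists z.
pose V y := sval (cid (h y)).
have Vcl y : closure (range T) (V y) by rewrite /V; case: cid => /= z [].
have VE x y : dot (S x) y = dot (T x) (V y) by rewrite /V; case: cid => /= z [].
(* The representing vector is unique within the closure of the range; linearity of [V] follows. *)
have Vinj y z : closure (range T) z -> (forall x, dot (S x) y = dot (T x) z) -> V y = z.
  move=> cz hz.
  have o x : dot (T x) (V y - z) = 0 by rewrite dotBr -VE hz subrr.
  apply/subr0_eq/dotxx_eq0; rewrite {1}dotBl.
  by rewrite !(closure_orth _ _ (A := range T)) ?subrr// => _ [x _ <-].
have lV : linear V.
  move=> a y z; apply: Vinj => [|x]; last by rewrite !dotDr !dotZr !VE.
  apply/(closure_rangeP _ lT) => w Tw.
  by rewrite dotDl dotZl !(closure_orth _ (Vcl _)) ?mulr0 ?addr0// => _ [x _ <-].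
have cV : contractive V.
  move=> y; have [Vy0|Vy0] := eqVneq (V y) 0; first by rewrite Vy0 normr0.
  rewrite -subr_ge0; apply/negPn/negP => hlt.
  have re : `|y| < `|V y|.
    rewrite real_ltNge ?ger0_real//; move: hlt; by rewrite subr_ge0.
  (* Divided by |V y| + |y|, this is the distance within which some T x approximates V y; the
     estimate of <V y, V y> then falls strictly below |V y|^2. *)
  have e0 : 0 < `|V y| * (`|V y| - `|y|).
    by rewrite mulr_gt0 ?subr_gt0 ?normr_gt0.
  have VVx x : `|dot (T x) (V y)| <= `|T x| * `|y|.
    by rewrite -VE; apply: le_trans (Defs.CauchySchwarz _ _) _; apply: ler_wpM2r.
  have s0 : 0 < `|V y| + `|y| by rewrite ltr_pwDl ?normr_gt0.
  have /closure_normP/(_ _ (divr_gt0 e0 s0))[_ [x _ <-] Tx] := Vcl y.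
  have : `|V y| ^+ 2 < `|V y| ^+ 2.
    rewrite -{1}dotxx -{1}[V y](subrK (T x)) dotDl.
    have h1 : `|dot (V y - T x) (V y) + dot (T x) (V y)| <=
       `|V y - T x| * `|V y| + (`|V y| + `|V y - T x|) * `|y|.
      apply: le_trans (ler_normD _ _) _; apply: lerD; first exact: Defs.CauchySchwarz.
      apply: le_trans (VVx _) _; apply: ler_wpM2r => //.
      rewrite -{1}[T x](subKr (V y)); exact: ler_normB.
    have -> : dot (V y - T x) (V y) + dot (T x) (V y) = `|V y| ^+ 2.
      by rewrite -dotDl subrK dotxx.
    have := h1; rewrite -dotDl subrK dotxx ger0_norm ?exprn_ge0//.
    move=> /le_lt_trans; apply.
    have -> : `|V y - T x| * `|V y| + (`|V y| + `|V y - T x|) * `|y| =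
       `|V y - T x| * (`|V y| + `|y|) + `|V y| * `|y| by ring.
    move: Tx; rewrite ltr_pdivlMr// => Tx.
    rewrite -ltrBrDr; apply: lt_le_trans Tx _.
    by rewrite mulrBr expr2.
  by rewrite ltxx.
have bV := contractive_bounded lV cV.
exists (adj V); split; [exact: adj_linear | exact: adj_contractive|].
by move=> x; apply: dotr_inj => y; rewrite (adjEl bV) VE.
Qed.

(** Replacing z by a nearby T x costs the distance once in |z| and once in |W z|, whence the
    constant 2. *)
Lemma douglas_factor_isometry (X : lmodType R[i]) H K (T : X -> H) (W : H -> K) z :
  linear W -> contractive W -> (forall x, `|W (T x)| = `|T x|) ->
  closure (range T) z -> `|W z| = `|z|.
Proof.
move=> lW cW WT /closure_normP cz; apply/eqP; rewrite eq_sym -subr_eq0; apply/eqP.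
apply: (@le_inv_nat_eq0 _ _ 2%:R) => // [|n]; first by rewrite subr_ge0.
have [|_ [x _ <-] /ltW xz] := cz n.+1%:R^-1; first by rewrite invr_gt0 ltr0n.
rewrite lerBlDr.
have -> : 2%:R / n.+1%:R + `|W z| = n.+1%:R^-1 + (n.+1%:R^-1 + `|W z|) by ring.
rewrite -{1}[z](subrK (T x)); apply: le_trans (ler_normD _ _) _; apply: lerD => //.
rewrite -WT -{1}[T x](subKr z) (linB lW) [leRHS]addrC.
apply: le_trans (ler_normB _ _) _; rewrite lerD2l//.
exact: le_trans (cW _) _.
Qed.

(** Polarisation: |x + y| determines the real part of <x, y>, and ['i *: x] in place of x gives the
    imaginary part. *)
Lemma isometry_dot H K (U : H -> K) : linear U -> (forall x, `|U x| = `|x|) ->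
  forall x y, dot (U x) (U y) = dot x y.
Proof.
move=> lU nU.
have re x y : dot (U x) (U y) + (dot (U x) (U y))^* = dot x y + (dot x y)^*.
  have := sqr_normD x y; rewrite -[in LHS]nU (linD lU) sqr_normD !nU.
  by move=> /addrI.
move=> x y; have h1 := re x y; have := re ('i *: x) y.
rewrite (linZ lU) !dotZl !rmorphM /= conjCi !mulNr -!mulrBr.
move=> /(mulfI (neq0Ci _)) h2.
have two (a b : R[i]) : a *+ 2 = (a + b) + (a - b) by ring.
have : dot (U x) (U y) *+ 2 = dot x y *+ 2.
  by rewrite (two _ (dot (U x) (U y))^*) h1 h2 -two.
by move=> /eqP; rewrite eqrMn2r => /eqP.
Qed.

Section ClosedRange.
Variables (H K : hilbertType R) (S : {linear H -> K}).
Implicit Types u v : csub (clran S).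

Lemma csub_dot (Z : hilbertType R) (L : closed_subspace Z) (u v : csub L) :
  dot u v = dot (csub_val u) (csub_val v).
Proof. by []. Qed.

Lemma csub_closure u : closure (range S) (csub_val u).
Proof. by have /asboolP := csub_valP u. Qed.

Lemma to_clran_linear : linear (to_clran S).
Proof. by move=> a x y; apply/val_inj; rewrite /= linearP. Qed.

Lemma to_clran0 : to_clran S 0 = 0.
Proof. exact: lin0 to_clran_linear. Qed.

Lemma csub_orth u y : (forall x, dot (S x) y = 0) -> dot (csub_val u) y = 0.
Proof. by move=> Sy; apply: closure_orth _ (@csub_closure u) => _ [x _ <-]. Qed.

(** The difference lies in the closure of the range and is orthogonal to the range, hence to
    itself. *)
Lemma to_clran_inj u v :
  (forall x, dot (csub_val u) (S x) = dot (csub_val v) (S x)) -> u = v.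
Proof.
move=> uv; apply/subr0_eq/dotxx_eq0; rewrite csub_dot csub_orth// => x.
by rewrite dotC /= dotBl uv subrr conjC0.
Qed.

Lemma to_clran_dense u : closure (range (to_clran S)) u.
Proof.
apply/(closure_rangeP _ to_clran_linear) => v Sv.
suff -> : v = 0 by rewrite dot0r.
apply: to_clran_inj => x; rewrite dotC /= dot0l -[dot _ _]/(dot (to_clran S x) v).
by rewrite Sv conjC0.
Qed.

End ClosedRange.

(** For each y, F^* y - G^* y is orthogonal to the dense range of [T]. *)
Lemma bounded_op_eq_dense (X : lmodType R[i]) H K (T : X -> H) (F G : H -> K) :
  bounded_op F -> bounded_op G -> linear T -> (forall z, closure (range T) z) ->
  (forall x, F (T x) = G (T x)) -> F = G.
Proof.
move=> bF bG lT cT FG; apply/funext => z; apply: dotr_inj => y.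
rewrite (adjE bF) (adjE bG); apply/subr0_eq; rewrite -dotBr.
by apply: closure_orth _ (cT z) => _ [x _ <-]; rewrite dotBr -adjE// -adjE// FG subrr.
Qed.

End BoundedOperators.

Arguments csub_closure {R H K S} u B _.
Arguments to_clran_dense {R H K S} u B _.

(** * Square roots and defect operators *)

Section InvNatLimits.
Variable R : realType.
Implicit Types H : hilbertType R.

Lemma le_inv_nat_le (a b c : R[i]) : a \is Num.real -> b \is Num.real -> 0 <= c ->
  (forall n : nat, a <= b + c * n.+1%:R^-1) -> a <= b.
Proof.
move=> ar br c0 h; rewrite real_leNgt//; apply/negP => ba.
have ab0 : 0 < a - b by rewrite subr_gt0.
have h' n : a - b <= c * n.+1%:R^-1 by rewrite lerBlDl.
by have /eqP := le_inv_nat_eq0 (ltW ab0) c0 h'; rewrite gt_eqF.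
Qed.

Lemma inv_nat_lim_unique H (u : nat -> H) (l l' : H) (c c' : R[i]) : 0 <= c -> 0 <= c' ->
  (forall n, `|l - u n| <= c * n.+1%:R^-1) -> (forall n, `|l' - u n| <= c' * n.+1%:R^-1) ->
  l = l'.
Proof.
move=> c0 c0' h h'; apply/subr0_eq/eqP; rewrite -normr_eq0; apply/eqP.
apply: (le_inv_nat_eq0 (c := c + c')) => // [|n]; first exact: addr_ge0.
have -> : l - l' = (l - u n) - (l' - u n) by rewrite opprB addrA subrK.
by apply: le_trans (ler_normB _ _) _; rewrite mulrDl lerD.
Qed.

End InvNatLimits.

Section SquareRoot.
Variable R : realType.
Implicit Types H K : hilbertType R.

(* Y_(n+1) = (B + Y_n^2) / 2 increases to I - (I - B)^(1/2). For B = I the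
   iterates are the scalars 1 - rate n, which dominate the general case. *)
Fixpoint sqrt_iter H (B : H -> H) (n : nat) : H -> H :=
  if n is m.+1 then fun x => 2%:R^-1 *: (B x + sqrt_iter B m (sqrt_iter B m x))
  else fun=> 0.

Fixpoint rate (n : nat) : R[i] :=
  if n is m.+1 then rate m - rate m ^+ 2 / 2%:R else 1.

Lemma rate_ge0_le1 n : 0 <= rate n <= 1.
Proof.
elim: n => [|n /andP[h0 h1]] /=; first by rewrite ler01 lexx.
have h2 : rate n ^+ 2 / 2%:R <= rate n.
  rewrite ler_pdivrMr ?ltr0n// expr2; apply: ler_wpM2l => //.
  by apply: le_trans h1 _; rewrite ler1n.
rewrite subr_ge0 h2 /=; apply: le_trans h1.
by rewrite gerBl divr_ge0 ?exprn_ge0 ?ler0n.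
Qed.

Lemma rate_le n : rate n <= 2%:R * n.+1%:R^-1.
Proof.
(* The induction runs on the sharper constant [n.+2], for which the next gap is a nonnegative
   multiple of the current one plus half a square. *)
suff h : n.+2%:R * rate n <= 2%:R.
  have /andP[r0 _] := rate_ge0_le1 n.
  rewrite ler_pdivlMr ?ltr0n//; apply: le_trans h.
  by rewrite mulrC; apply: ler_wpM2r => //; rewrite ler_nat.
elim: n => [|n IH]; first by rewrite mulr1.
have /andP[r0 r1] := rate_ge0_le1 n.
rewrite -subr_ge0.
have -> : 2%:R - n.+3%:R * rate n.+1 =
   (2%:R - n.+2%:R * rate n) * (1 - rate n / 2%:R) + rate n ^+ 2 / 2%:R.
  by rewrite /= [n.+3%:R]mulrS; field.
rewrite addr_ge0 ?divr_ge0 ?exprn_ge0 ?ler0n//.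
rewrite mulr_ge0 ?subr_ge0// ler_pdivrMr ?ltr0n// mul1r.
by apply: le_trans r1 _; rewrite ler1n.
Qed.

Section Iteration.
Variables (H : hilbertType R) (B : H -> H).
Hypotheses (lB : linear B) (cB : contractive B).
Local Notation Y := (sqrt_iter B).

Lemma sqrt_iter_linear n : linear (Y n).
Proof.
elim: n => [|n IH] a x y /=; first by rewrite scaler0 addr0.
by rewrite lB !IH addrACA -scalerDr [LHS]scalerDr !scalerA mulrC.
Qed.

Lemma sqrt_iter_bound n x : `|Y n x| <= (1 - rate n) * `|x|.
Proof.
elim: n x => [|n IH] x /=; first by rewrite normr0 subrr mul0r.
have /andP[r0 r1] := rate_ge0_le1 n.
rewrite normrZ ger0_norm ?invr_ge0 ?ler0n//.
rewrite mulrC ler_pdivrMr ?ltr0n//; apply: le_trans (ler_normD _ _) _.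
apply: (@le_trans _ _ (`|x| + (1 - rate n) * ((1 - rate n) * `|x|))).
  apply: lerD => //; apply: le_trans (IH _) _; apply: ler_wpM2l => //.
  by rewrite subr_ge0.
by rewrite le_eqVlt; apply/orP; left; apply/eqP; field.
Qed.

(** A difference of squares is factored as P^2 - Q^2 = P (P - Q) + (P - Q) Q, which needs no
    commutation; both terms are then bounded by their scalar counterparts. *)
Lemma sqrt_iter_step n x : `|Y n.+1 x - Y n x| <= (rate n - rate n.+1) * `|x|.
Proof.
elim: n x => [|n IH] x.
  rewrite /= subr0 addr0 normrZ ger0_norm ?invr_ge0 ?ler0n//.
  by rewrite expr1n opprB addrC subrK mul1r; apply: ler_wpM2l; rewrite ?invr_ge0 ?ler0n.
have -> : Y n.+2 x - Y n.+1 x =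
   2%:R^-1 *: (Y n.+1 (Y n.+1 x - Y n x) + (Y n.+1 (Y n x) - Y n (Y n x))).
  rewrite (linB (sqrt_iter_linear n.+1)) addrA subrK.
  rewrite -[Y n.+2 x]/(2%:R^-1 *: (B x + Y n.+1 (Y n.+1 x))).
  rewrite -[in X in _ - X]/(2%:R^-1 *: (B x + Y n (Y n x))).
  by rewrite -scalerBr opprD addrACA subrr add0r.
have /andP[r0 r1] := rate_ge0_le1 n.
have /andP[s0 s1] := rate_ge0_le1 n.+1.
have d0 : 0 <= rate n - rate n.+1.
  by rewrite /= opprB addrC subrK divr_ge0 ?exprn_ge0 ?ler0n.
rewrite normrZ ger0_norm ?invr_ge0 ?ler0n//.
rewrite mulrC ler_pdivrMr ?ltr0n//; apply: le_trans (ler_normD _ _) _.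
apply: (@le_trans _ _ ((1 - rate n.+1) * ((rate n - rate n.+1) * `|x|) +
  (rate n - rate n.+1) * ((1 - rate n) * `|x|))).
  apply: lerD.
    apply: le_trans (sqrt_iter_bound _ _) _; apply: ler_wpM2l; last exact: IH.
    by rewrite subr_ge0.
  apply: le_trans (IH _) _; apply: ler_wpM2l => //; exact: sqrt_iter_bound.
by rewrite le_eqVlt; apply/orP; left; apply/eqP => /=; field.
Qed.

Lemma sqrt_iter_cauchy x m n : (n <= m)%N ->
  `|Y m x - Y n x| <= 2%:R * `|x| * n.+1%:R^-1.
Proof.
move=> nm; apply: (@le_trans _ _ ((rate n - rate m) * `|x|)).
  elim: m nm => [|m IH]; first by rewrite leqn0 => /eqP->; rewrite !subrr normr0 mul0r.
  rewrite leq_eqVlt => /predU1P[->|]; first by rewrite !subrr normr0 mul0r.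
  rewrite ltnS => /IH{}IH.
  have -> : Y m.+1 x - Y n x = (Y m.+1 x - Y m x) + (Y m x - Y n x) by rewrite addrA subrK.
  apply: le_trans (ler_normD _ _) (le_trans (lerD (sqrt_iter_step _ _) IH) _).
  by rewrite -mulrDl [X in X * _]addrC addrA subrK.
rewrite mulrAC; apply: ler_wpM2r => //; apply: le_trans (rate_le n).
by rewrite gerBl; case/andP: (rate_ge0_le1 m).
Qed.

(** This is I - (I - B)^(1/2) when [B] is a self-adjoint contraction; the rate alone pins down the
    limit. *)
Definition sqrt_lim (x : H) : H :=
  xget 0 [set l | forall n, `|l - Y n x| <= 2%:R * `|x| * n.+1%:R^-1].

Lemma sqrt_limP x n : `|sqrt_lim x - Y n x| <= 2%:R * `|x| * n.+1%:R^-1.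
Proof.
have c0 : 0 <= 2%:R * `|x| by rewrite mulr_ge0 ?ler0n.
have [l hl] := inv_nat_cvg c0 (@sqrt_iter_cauchy x).
by rewrite /sqrt_lim; case: xgetP => [l' _ /(_ n)//|/(_ l)]; case.
Qed.

Lemma sqrt_lim_unique x l c : 0 <= c ->
  (forall n, `|l - Y n x| <= c * n.+1%:R^-1) -> l = sqrt_lim x.
Proof.
move=> c0 hl; apply: inv_nat_lim_unique c0 _ hl (sqrt_limP x).
by rewrite mulr_ge0 ?ler0n.
Qed.

Lemma sqrt_lim_linear : linear sqrt_lim.
Proof.
move=> a x y; apply/esym/(@sqrt_lim_unique _ _ (`|a| * (2%:R * `|x|) + 2%:R * `|y|)).
  by rewrite addr_ge0 ?mulr_ge0 ?ler0n.
move=> n; rewrite sqrt_iter_linear.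
have -> : a *: sqrt_lim x + sqrt_lim y - (a *: Y n x + Y n y) =
   a *: (sqrt_lim x - Y n x) + (sqrt_lim y - Y n y) by rewrite scalerBr opprD addrACA.
apply: le_trans (ler_normD _ _) _; rewrite mulrDl; apply: lerD; last exact: sqrt_limP.
by rewrite normrZ -mulrA; apply: ler_wpM2l => //; exact: sqrt_limP.
Qed.

Lemma sqrt_iter_contractive n : contractive (Y n).
Proof.
move=> x; apply: le_trans (sqrt_iter_bound n x) _; rewrite -[leRHS]mul1r.
by apply: ler_wpM2r => //; rewrite gerBl; case/andP: (rate_ge0_le1 n).
Qed.

Lemma sqrt_lim_contractive : contractive sqrt_lim.
Proof.
move=> x; apply: (@le_inv_nat_le _ _ _ (2%:R * `|x|)).
- exact: ger0_real.
- exact: ger0_real.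
- by rewrite mulr_ge0 ?ler0n.
move=> n; rewrite -[sqrt_lim x](subrK (Y n x)) addrC.
by apply: le_trans (ler_normD _ _) _; apply: lerD;
  [exact: sqrt_iter_contractive | exact: sqrt_limP].
Qed.

(** Both sides are limits of Y_(n+1) x. Writing Y for the limit operator, the equation says (I -
    Y)^2 = I - B. *)
Lemma sqrt_lim_fix x : sqrt_lim x = 2%:R^-1 *: (B x + sqrt_lim (sqrt_lim x)).
Proof.
have c0 : 0 <= 2%:R * `|x| by rewrite mulr_ge0 ?ler0n.
apply: (@inv_nat_lim_unique _ _ (fun n => Y n.+1 x) _ _ _ _ c0 c0) => n.
  apply: le_trans (sqrt_limP _ _) _; apply: ler_wpM2l => //.
  by rewrite lef_pV2 ?posrE ?ltr0n// ler_nat.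
rewrite -[Y n.+1 x]/(2%:R^-1 *: (B x + Y n (Y n x))) -scalerBr opprD addrACA subrr add0r.
rewrite normrZ ger0_norm ?invr_ge0 ?ler0n// mulrC ler_pdivrMr ?ltr0n//.
have -> : sqrt_lim (sqrt_lim x) - Y n (Y n x) =
  (sqrt_lim (sqrt_lim x) - Y n (sqrt_lim x)) + Y n (sqrt_lim x - Y n x).
  by rewrite (linB (sqrt_iter_linear n)) addrA subrK.
apply: le_trans (ler_normD _ _) _; rewrite mulr_natr mulr2n; apply: lerD.
  apply: le_trans (sqrt_limP _ _) _; apply: ler_wpM2r; first by rewrite invr_ge0 ler0n.
  by apply: ler_wpM2l; rewrite ?ler0n// sqrt_lim_contractive.
exact: le_trans (sqrt_iter_contractive _ _) (sqrt_limP _ _).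
Qed.

Lemma sqrt_lim_sym : (forall x y, dot (B x) y = dot x (B y)) ->
  forall x y, dot (sqrt_lim x) y = dot x (sqrt_lim y).
Proof.
move=> sB.
have sY n x y : dot (Y n x) y = dot x (Y n y).
  elim: n x y => [|n IH] x y /=; first by rewrite dot0l dot0r.
  by rewrite dotZl dotZr dotDl dotDr sB !IH fmorphV /= conjC_nat.
move=> x y; apply/eqP; rewrite -subr_eq0 -normr_eq0; apply/eqP.
apply: (@le_inv_nat_eq0 _ _ (2%:R * `|x| * `|y| + `|x| * (2%:R * `|y|))) => // [|n].
  by rewrite addr_ge0 ?mulr_ge0 ?ler0n.
have -> : dot (sqrt_lim x) y - dot x (sqrt_lim y) =
   dot (sqrt_lim x - Y n x) y - dot x (sqrt_lim y - Y n y).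
  by rewrite dotBl dotBr sY; ring.
apply: le_trans (ler_normB _ _) _; rewrite mulrDl; apply: lerD.
  apply: le_trans (Defs.CauchySchwarz _ _) _; rewrite mulrAC.
  by apply: ler_wpM2r => //; exact: sqrt_limP.
apply: le_trans (Defs.CauchySchwarz _ _) _; rewrite -mulrA.
by apply: ler_wpM2l => //; exact: sqrt_limP.
Qed.

End Iteration.

(** The iterates are polynomials in [B], so [T] intertwines them and then their limits. With one
    space this is commutation with the square root; with two it relates the two defect operators of
    a contraction. *)
Lemma sqrt_lim_intertwine H K (B : H -> H) (B' : K -> K) (T : H -> K) :
  linear B -> contractive B -> linear B' -> contractive B' -> bounded_op T ->
  (forall x, T (B x) = B' (T x)) ->
  forall x, T (sqrt_lim B x) = sqrt_lim B' (T x).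
Proof.
move=> lB cB lB' cB' /bounded_opP[lT [c c0 Tc]] TB x.
have TY n y : T (sqrt_iter B n y) = sqrt_iter B' n (T y).
  elim: n y => [|n IH] y /=; first exact: lin0.
  by rewrite (linZ lT) (linD lT) TB !IH.
apply: (@sqrt_lim_unique _ B' lB' cB' _ _ (c * (2%:R * `|x|))).
  by rewrite !mulr_ge0 ?ler0n.
move=> n; rewrite -TY -(linB lT); apply: le_trans (Tc _) _.
by rewrite -mulrA; apply: ler_wpM2l => //; exact: sqrt_limP.
Qed.

Lemma positive_op_sym H (S : H -> H) : positive_op S ->
  forall x y, dot (S x) y = dot x (S y).
Proof.
move=> [[lS _] S0].
have re x : dot (S x) x = dot x (S x).
  by rewrite dotC; apply/CrealP/ger0_real; rewrite dotC conjC_ge0.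
have h x y : dot (S x) y + dot (S y) x = dot x (S y) + dot y (S x).
  have := re (x + y); rewrite (linD lS) !dotDl !dotDr !re => /eqP.
  rewrite -subr_eq0 => /eqP e; apply/eqP; rewrite -subr_eq0 -e; apply/eqP; ring.
move=> x y; have h1 := h x y; have := h ('i *: x) y.
rewrite (linZ lS) !dotZl !dotZr conjCi !mulNr => h2.
have {}h2 : dot (S x) y - dot (S y) x = dot x (S y) - dot y (S x).
  by apply: (mulfI (neq0Ci _)); rewrite !mulrBr.
have two (a b : R[i]) : a *+ 2 = (a + b) + (a - b) by ring.
have : dot (S x) y *+ 2 = dot x (S y) *+ 2 by rewrite (two _ (dot (S y) x)) h1 h2 -two.
by move=> /eqP; rewrite eqrMn2r => /eqP.
Qed.

(** Positivity at y - t S y with t = 1/(n+1) gives 2 |S y|^2 <= t <S S y, S y>; then n tends to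
    infinity. *)
Lemma positive_op_ker H (S : H -> H) y : positive_op S -> dot (S y) y = 0 -> S y = 0.
Proof.
move=> pS y0; have [[lS _] S0] := pS; have sS := positive_op_sym pS.
apply/dotxx_eq0; rewrite dotxx.
apply: (@le_inv_nat_eq0 _ _ (dot (S (S y)) (S y))) => // [|n]; first by rewrite exprn_ge0.
pose t : R[i] := n.+1%:R^-1.
have t0 : 0 < t by rewrite invr_gt0 ltr0n.
have tr : t^* = t by apply/CrealP/ger0_real/ltW.
have := S0 (y - t *: S y).
rewrite (linB lS) (linZ lS) dotBl !dotBr !dotZl !dotZr tr y0 sub0r.
rewrite [dot (S (S y)) y]sS dotxx => h.
have {}h : 0 <= t * (dot (S (S y)) (S y) * t - `|S y| ^+ 2 *+ 2).
  by apply: le_trans h _; rewrite le_eqVlt; apply/orP; left; apply/eqP; ring.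
move: h; rewrite pmulr_rge0// subr_ge0; apply: le_trans.
by rewrite mulr2n lerDl exprn_ge0.
Qed.

Definition root_compl H (B : H -> H) : H -> H := fun x => x - sqrt_lim B x.

Section RootOfComplement.
Variables (H : hilbertType R) (B : H -> H).
Hypotheses (lB : linear B) (cB : contractive B).
Hypothesis sB : forall x y, dot (B x) y = dot x (B y).

Lemma root_compl_positive : positive_op (root_compl B).
Proof.
have lY := sqrt_lim_linear lB cB; have cY := sqrt_lim_contractive lB cB.
split.
  apply: bounded_opD; first exact: bounded_op_id.
  exact/bounded_opN/contractive_bounded.
move=> x; rewrite dotBl subr_ge0.
have h : `|dot (sqrt_lim B x) x| <= dot x x.
  rewrite dotxx expr2; apply: le_trans (Defs.CauchySchwarz _ _) _.
  by apply: ler_wpM2r => //; exact: cY.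
apply: le_trans h; apply: real_ler_norm.
by apply/CrealP; rewrite -dotC sqrt_lim_sym.
Qed.

Lemma root_complK x : root_compl B (root_compl B x) = x - B x.
Proof.
rewrite /root_compl (linB (sqrt_lim_linear lB cB)) opprB addrA.
have h := sqrt_lim_fix lB cB x.
have -> : sqrt_lim B (sqrt_lim B x) = sqrt_lim B x *+ 2 - B x.
  by rewrite {2}h -scaler_nat scalerA mulfV ?pnatr_eq0// scale1r addrC addKr.
by rewrite mulr2n !addrA subrK addrAC addrK.
Qed.

(** [S] commutes with B = I - S^2, hence with the constructed root r. For y = (S - r) x this gives
    (S + r) y = 0, so <S y, y> and <r y, y> vanish, then S y = r y = 0, and finally |y|^2 = <x, (S -
    r) y> = 0. *)
Lemma root_compl_unique S : positive_op S -> (forall x, S (S x) = x - B x) ->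
  S = root_compl B.
Proof.
move=> pS SS; have pr := root_compl_positive.
have [[lS _] S0] := pS; have [[lr _] r0] := pr; have bS := pS.1.
have BS x : S (B x) = B (S x).
  have e x' : B x' = x' - S (S x') by rewrite SS opprB addrC subrK.
  by rewrite !e (linB lS).
have Sr x : S (root_compl B x) = root_compl B (S x).
  by rewrite /root_compl (linB lS) (sqrt_lim_intertwine lB cB lB cB bS BS).
apply/funext => x; set r := root_compl B in pr lr r0 Sr *.
pose y := S x - r x.
have h : dot (S y) y + dot (r y) y = 0.
  rewrite -dotDl (_ : S y + r y = 0) ?dot0l//.
  by rewrite /y (linB lS) (linB lr) SS /r root_complK -/r Sr addrC addrA subrK subrr.
have /eqP := h; rewrite paddr_eq0// => /andP[/eqP Sy /eqP ry].
have {Sy} Sy := positive_op_ker pS Sy; have {ry} ry := positive_op_ker pr ry.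
apply/subr0_eq/dotxx_eq0; rewrite -/y {1}/y dotBl.
by rewrite (positive_op_sym pS) (positive_op_sym pr) Sy ry subrr.
Qed.

End RootOfComplement.

Lemma psqrt_root_compl H (B : H -> H) : linear B -> contractive B ->
  (forall x y, dot (B x) y = dot x (B y)) ->
  psqrt (fun x => x - B x) = root_compl B.
Proof.
move=> lB cB sB; rewrite /psqrt; case: xgetP => [S _ [pS SS]|/(_ (root_compl B))].
  by apply: root_compl_unique => // x; rewrite -[LHS]/((S \o S) x) SS.
case; split; first exact: root_compl_positive.
by apply/funext => x; exact: root_complK.
Qed.

End SquareRoot.

(** * Defect operators of a contraction *)

Section Defects.
Variables (R : realType) (H K : hilbertType R) (T : H -> K).
Hypotheses (bT : bounded_op T) (cT : contractive T).
Let bT' : bounded_op (adj T). Proof. exact: adj_bounded. Qed.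
Let lT : linear T. Proof. exact: bounded_op_linear. Qed.
Let lT' : linear (adj T). Proof. exact: bounded_op_linear. Qed.

Let lB : linear (fun x => adj T (T x)).
Proof. by move=> a x y; rewrite lT lT'. Qed.
Let cB : contractive (fun x => adj T (T x)).
Proof. by move=> x; apply: le_trans (adj_contractive bT cT _) (cT _). Qed.
Let sB x y : dot (adj T (T x)) y = dot x (adj T (T y)).
Proof. by rewrite (adjEl bT) (adjE bT). Qed.
Let lB' : linear (fun x => T (adj T x)).
Proof. by move=> a x y; rewrite lT' lT. Qed.
Let cB' : contractive (fun x => T (adj T x)).
Proof. by move=> x; apply: le_trans (cT _) (adj_contractive bT cT _). Qed.
Let sB' x y : dot (T (adj T x)) y = dot x (T (adj T y)).
Proof. by rewrite (adjE bT) (adjEl bT). Qed.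

Let defectE : defect T = root_compl (fun x => adj T (T x)).
Proof. exact: psqrt_root_compl. Qed.
Let defect_starE : defect_star T = root_compl (fun x => T (adj T x)).
Proof. exact: psqrt_root_compl. Qed.

Lemma defect_bounded : bounded_op (defect T).
Proof. by rewrite defectE; case: (root_compl_positive lB cB sB). Qed.

Lemma defect_star_bounded : bounded_op (defect_star T).
Proof. by rewrite defect_starE; case: (root_compl_positive lB' cB' sB'). Qed.

Lemma defect_sym x y : dot (defect T x) y = dot x (defect T y).
Proof. by rewrite defectE; apply: positive_op_sym; exact: root_compl_positive. Qed.

Lemma defect_star_sym x y : dot (defect_star T x) y = dot x (defect_star T y).
Proof. by rewrite defect_starE; apply: positive_op_sym; exact: root_compl_positive. Qed.

Lemma defectK x : defect T (defect T x) = x - adj T (T x).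
Proof. by rewrite defectE root_complK. Qed.

Lemma defect_starK x : defect_star T (defect_star T x) = x - T (adj T x).
Proof. by rewrite defect_starE root_complK. Qed.

Lemma defect_dot x y : dot (defect T x) (defect T y) = dot x y - dot (T x) (T y).
Proof. by rewrite -defect_sym defectK dotBl (adjEl bT). Qed.

Lemma defect_star_dot x y :
  dot (defect_star T x) (defect_star T y) = dot x y - dot (adj T x) (adj T y).
Proof. by rewrite -defect_star_sym defect_starK dotBl (adjE bT). Qed.

Lemma defect_norm x : `|defect T x| ^+ 2 = `|x| ^+ 2 - `|T x| ^+ 2.
Proof. by rewrite -!dotxx defect_dot. Qed.

Lemma defect_star_norm x : `|defect_star T x| ^+ 2 = `|x| ^+ 2 - `|adj T x| ^+ 2.
Proof. by rewrite -!dotxx defect_star_dot. Qed.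

Lemma defect_star_contractive : contractive (defect_star T).
Proof. by move=> x; rewrite -sqr_norm_le defect_star_norm gerBl exprn_ge0. Qed.

(** [T] intertwines T^* T with T T^*, hence their complements' square roots. *)
Lemma defect_intertwine x : T (defect T x) = defect_star T (T x).
Proof.
rewrite defectE defect_starE /root_compl (linB lT).
by rewrite (sqrt_lim_intertwine lB cB lB' cB' bT).
Qed.

Lemma defect_star_intertwine y : adj T (defect_star T y) = defect T (adj T y).
Proof.
rewrite defectE defect_starE /root_compl (linB lT').
by rewrite (sqrt_lim_intertwine lB' cB' lB cB bT').
Qed.

Lemma defect_space_inj (u : defect_space T) : defect T (csub_val u) = 0 -> u = 0.
Proof.
move=> u0; apply: to_clran_inj => x.
by rewrite -defect_sym u0 /= !dot0l.
Qed.

Lemma defect_star_space_inj (u : defect_star_space T) :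
  defect_star T (csub_val u) = 0 -> u = 0.
Proof.
move=> u0; apply: to_clran_inj => x.
by rewrite -defect_star_sym u0 /= !dot0l.
Qed.

(** If [defect_star T] kills y, then [defect T] kills T^* y by intertwining, so T^* y is orthogonal
    to the defect space. *)
Lemma defect_space_mem (u : defect_space T) :
  T (csub_val u) \in csub_pred (clran (defect_star T)).
Proof.
apply/asboolP; apply/(closure_rangeP _ (bounded_op_linear defect_star_bounded)) => y Dy.
rewrite (adjE bT); apply: csub_orth => x.
rewrite defect_sym -defect_star_intertwine -(adjE bT).
by rewrite -defect_star_sym Dy.
Qed.

Lemma defect_star_space_mem (u : defect_star_space T) :
  adj T (csub_val u) \in csub_pred (clran (defect T)).
Proof.
apply/asboolP; apply/(closure_rangeP _ (bounded_op_linear defect_bounded)) => y Dy.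
rewrite (adjEl bT); apply: csub_orth => x.
rewrite defect_star_sym -defect_intertwine.
have -> : defect T y = 0 by apply: dotl_inj => z; rewrite -defect_sym Dy dot0r.
by rewrite (lin0 lT) dot0r.
Qed.

End Defects.

#[local] Existing Instance totally_filter.

(** * Finite direct sums and row operators *)

Section FiniteSums.
Variables (R : realType) (d : nat) (H : hilbertType R).
Implicit Types (x y : l2 'I_d H) (T : 'I_d -> H -> H).

Lemma l2_ord_mkl2E (f : 'I_d -> H) i : mkl2 f i = f i.
Proof.
apply: mkl2E; exists (\sum_(j < d) `|f j| ^+ 2) => A.
rewrite (_ : \sum_(j < d) _ = \sum_(j <- [fset j | j in 'I_d]%fset) `|f j| ^+ 2); last first.
  rewrite big_imfset//= ?enumT//; by rewrite big_enum.
rewrite [leRHS](@sum_fset_split R _ (fun j => `|f j| ^+ 2) A).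
  by rewrite lerDl sumr_ge0// => j _; rewrite exprn_ge0.
by apply/fsubsetP => j _; apply/imfsetP; exists j.
Qed.

Lemma l2_ord_dot x y : dot x y = \sum_(i < d) dot (x i) (y i).
Proof.
apply: l2_dotE.
have H0 : (fun=> \sum_(i < d) dot (x i) (y i) : R[i]^o) @ @totally 'I_d -->
    (\sum_(i < d) dot (x i) (y i) : R[i]^o) by exact: (@cvg_cst R[i]^o).
refine (cvg_trans _ H0); apply: near_eq_cvg.
suff : totally [set A : {fset 'I_d} |
  \sum_(i < d) dot (x i) (y i) = partial_sum (fun i => dot (x i) (y i) : R[i]^o) A] by [].
exists [fset j | j in 'I_d]%fset => // A /= jA.
have -> : A = [fset j | j in 'I_d]%fset.
  apply/fsetP => j; have jI : j \in [fset j | j in 'I_d]%fset.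
    by apply/imfsetP; exists j.
  by rewrite jI (fsubsetP jA).
rewrite [RHS](@partial_sumE R) big_imfset//= ?enumT//; by rewrite big_enum.
Qed.

Lemma l2_ord_norm x : `|x| ^+ 2 = \sum_(i < d) `|x i| ^+ 2.
Proof. by rewrite -dotxx l2_ord_dot; apply: eq_bigr => i _; rewrite dotxx. Qed.

Definition single (i : 'I_d) (h : H) : l2 'I_d H := mkl2 (fun j => if j == i then h else 0).

Lemma singleE i h j : single i h j = if j == i then h else 0.
Proof. exact: l2_ord_mkl2E. Qed.

Lemma single_linear i : linear (single i).
Proof.
move=> a x y; apply: l2_eqP => j; rewrite -[RHS]/(a *: single i x j + single i y j).
by rewrite !singleE; case: (j == i); rewrite // scaler0 addr0.
Qed.

Lemma dot_single x i h : dot x (single i h) = dot (x i) h.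
Proof.
rewrite l2_ord_dot (bigD1 i)//= singleE eqxx big1 ?addr0// => j /negPf ji.
by rewrite singleE ji dot0r.
Qed.

Lemma l2_ord_sumE (F : 'I_d -> l2 'I_d H) j : (\sum_(i < d) F i) j = \sum_(i < d) F i j.
Proof. exact: (big_morph (fun x : l2 'I_d H => x j)). Qed.

Lemma single_decomp x : x = \sum_(i < d) single i (x i).
Proof.
apply: l2_eqP => j; rewrite l2_ord_sumE (bigD1 j)//= singleE eqxx big1 ?addr0// => i ij.
by rewrite singleE eq_sym (negPf ij).
Qed.

Lemma rowop_single T i h : (forall i, linear (T i)) -> rowop T (single i h) = T i h.
Proof.
move=> lT; rewrite /rowop (bigD1 i)//= singleE eqxx big1 ?addr0// => j /negPf ji.
by rewrite singleE ji lin0.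
Qed.

Lemma rowop_bounded T : (forall i, bounded_op (T i)) -> bounded_op (rowop T).
Proof.
move=> bT; apply/bounded_opP; split.
  move=> a x y; rewrite /rowop scaler_sumr -big_split/=; apply: eq_bigr => i _.
  by rewrite -(bounded_op_linear (bT i)).
have /choice[c hc] : forall i, exists c : R[i], 0 <= c /\ forall h : H, `|T i h| <= c * `|h|.
  by move=> i; have /bounded_opP[_ [c c0 Tc]] := bT i; exists c.
exists (\sum_(i < d) c i) => [|x]; first by apply: sumr_ge0 => i _; case: (hc i).
apply: le_trans (ler_norm_sum _ _ _) _; rewrite mulr_suml; apply: ler_sum => i _.
have [c0 ch] := hc i; apply: le_trans (ch _) _; apply: ler_wpM2l => //.
rewrite -sqr_norm_le l2_ord_norm (bigD1 i)//= lerDl sumr_ge0// => j _.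
by rewrite exprn_ge0.
Qed.

Lemma adj_rowop T h i : (forall i, bounded_op (T i)) -> adj (rowop T) h i = adj (T i) h.
Proof.
move=> bT; apply: dotr_inj => x; rewrite -dot_single (adjEl (rowop_bounded bT)).
rewrite rowop_single ?(adjEl (bT i))// => j; exact: bounded_op_linear.
Qed.

Lemma adj_rowop_norm T h : (forall i, bounded_op (T i)) ->
  `|adj (rowop T) h| ^+ 2 = dot (\sum_(i < d) T i (adj (T i) h)) h.
Proof.
move=> bT; rewrite -dotxx -(adjE (rowop_bounded bT)) /rowop.
by congr dot; apply: eq_bigr => i _; rewrite adj_rowop.
Qed.

(** The sum in [row_contraction] is |T^* h|^2 for the row operator, so the condition bounds the
    adjoint; taking adjoints again gives the row itself. *)
Lemma row_contraction_contractive T : row_contraction T -> contractive (rowop T).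
Proof.
move=> [bT cT]; have bR := rowop_bounded bT.
rewrite -(adjK bR); apply: (adj_contractive (adj_bounded bR)) => h.
by rewrite -sqr_norm_le -[leRHS]dotxx adj_rowop_norm.
Qed.

Lemma contractive_row_contraction T : (forall i, bounded_op (T i)) ->
  contractive (rowop T) -> row_contraction T.
Proof.
move=> bT cT; split=> // h; rewrite -adj_rowop_norm// dotxx sqr_norm_le.
by apply: adj_contractive => //; exact: rowop_bounded.
Qed.

Lemma wordop_bounded T w : (forall i, bounded_op (T i)) -> bounded_op (wordop T w).
Proof.
move=> bT; elim: w => [|k v IH]; first exact: bounded_op_id.
exact: bounded_op_comp.
Qed.

Lemma adj_wordop_cons T k v h : (forall i, bounded_op (T i)) ->
  adj (wordop T (k :: v)) h = adj (wordop T v) (adj (T k) h).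
Proof. by move=> bT; rewrite (adj_comp _ (bT k))//; exact: wordop_bounded. Qed.

Lemma adj_wordop_nil T h : adj (wordop T [::]) h = h.
Proof. by rewrite adj_id. Qed.

End FiniteSums.

(** * Multi-analytic operators on the Fock space *)

Section FockSpace.
Variables (R : realType) (d : nat).
Implicit Types (H K : hilbertType R) (w v : seq 'I_d) (i j k : 'I_d).

Definition word_tails i (A : {fset seq 'I_d}) : {fset seq 'I_d} :=
  [fset behead w | w in [fset w in A | ohead w == Some i]]%fset.

Lemma sum_word_tails i (A : {fset seq 'I_d}) (F : seq 'I_d -> R[i]) :
  \sum_(v <- word_tails i A) F (i :: v) = \sum_(w <- A | ohead w == Some i) F w.
Proof.
rewrite /word_tails big_imfset /=; last first.
  move=> [|a u] [|b v]; rewrite !inE/= ?andbF// => /andP[_ /eqP[->]] /andP[_ /eqP[->]].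
  by move=> ->.
rewrite big_fset /=; apply: eq_bigr => -[|a v] //= /eqP[->].
by [].
Qed.

(** Splitting by first letter is the inductive step for energy estimates over finite sets of words.
    It is an inequality because the empty word need not lie in [A]. *)
Lemma sum_words_le (A : {fset seq 'I_d}) (F : seq 'I_d -> R[i]) :
  (forall w, 0 <= F w) ->
  \sum_(w <- A) F w <= F [::] + \sum_(i < d) \sum_(v <- word_tails i A) F (i :: v).
Proof.
move=> F0.
pose G w : R[i] := if w is [::] then F [::] else 0.
have FE w : F w = G w + \sum_(i < d) (if ohead w == Some i then F w else 0).
  case: w => [|a v] /=; first by rewrite big1 ?addr0.
  rewrite add0r (bigD1 a)//= eqxx big1 ?addr0// => i /negPf ia.
  by rewrite (inj_eq Some_inj) eq_sym ia.
rewrite (eq_bigr _ (fun w _ => FE w)) big_split /= exchange_big /=; apply: lerD.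
  have [eA|eA] := boolP ([::] \in A).
    rewrite (big_fsetD1 [::])//= big1_fset ?addr0// => -[|a v]//.
    by rewrite !inE.
  rewrite big1_fset// => -[|a v]//=; by rewrite (negPf eA).
by apply: ler_sum => i _; rewrite sum_word_tails [leRHS]big_mkcond lexx.
Qed.

Lemma size_word_tails i (A : {fset seq 'I_d}) n :
  (forall w, w \in A -> (size w < n.+1)%N) -> forall v, v \in word_tails i A -> (size v < n)%N.
Proof.
move=> An v /imfsetP[/= w]; rewrite !inE => /andP[wA]; case: w wA => //= a u uA _ ->.
exact: (An _ uA).
Qed.

Lemma dot_vac H (x : fock d H) h : dot x (vac d h) = dot (x [::]) h.
Proof. exact: dot_etens. Qed.

Lemma vacE H (h : H) w : vac d h w = if w == [::] then h else 0.
Proof. exact: etensE. Qed.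

Lemma fockD H (x y : fock d H) w : (x + y) w = x w + y w. Proof. by []. Qed.

Lemma fockZ H a (x : fock d H) w : (a *: x) w = a *: x w. Proof. by []. Qed.

Lemma fock_sumE H n (F : 'I_n -> fock d H) w : (\sum_(i < n) F i) w = \sum_(i < n) F i w.
Proof. exact: (big_morph (fun x : fock d H => x w)). Qed.

Lemma vac_linear H : linear (@vac R d H).
Proof.
move=> a x y; apply: l2_eqP => w; rewrite fockD fockZ !vacE.
by case: eqP => // _; rewrite scaler0 addr0.
Qed.

Lemma vac_norm H (h : H) : `|vac d h| = `|h|.
Proof. by apply: sqr_norm_eq; rewrite -!dotxx dot_vac vacE. Qed.

Lemma vac_bounded H : bounded_op (@vac R d H).
Proof. by apply: contractive_bounded => [|x]; [exact: vac_linear | rewrite vac_norm]. Qed.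

Lemma creation_linear H i : linear (@creation R d H i).
Proof.
move=> a x y; apply: l2_eqP => w; rewrite fockD fockZ !creationE.
case: w => [|j v]; first by rewrite scaler0 addr0.
by case: (j == i); rewrite ?fockD ?fockZ ?scaler0 ?addr0.
Qed.

Lemma creation_bounded H i : bounded_op (@creation R d H i).
Proof.
apply: contractive_bounded => [|x]; first exact: creation_linear.
rewrite -sqr_norm_le; apply: l2_norm_le => A.
apply: le_trans (sum_words_le _ _) _ => [w|]; first by rewrite exprn_ge0.
rewrite creationE normr0 expr0n add0r (bigD1 i)//= [X in _ + X]big1 => [|j /negPf ji].
  rewrite addr0; apply: le_trans (l2_norm_ge x (word_tails i A)).
  by apply: ler_sum => v _; rewrite creationE eqxx.
by rewrite big1 // => v _; rewrite creationE ji normr0 expr0n.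
Qed.

Arguments vac_linear {H}.
Arguments vac_bounded {H}.
Arguments creation_linear {H} i.
Arguments creation_bounded {H} i.

Lemma adj_creationE H i (x : fock d H) w : adj (creation i) x w = x (i :: w).
Proof.
apply: dotr_inj => h; rewrite -!dot_etens (adjEl (creation_bounded i)).
by rewrite creation_etens.
Qed.

Lemma adj_creation_creation H i j (x : fock d H) :
  adj (creation i) (creation j x) = if i == j then x else 0.
Proof.
apply: l2_eqP => w; rewrite adj_creationE creationE.
by case: (i == j).
Qed.

Lemma adj_creation_vac H i (h : H) : adj (creation i) (vac d h) = 0.
Proof. by apply: l2_eqP => w; rewrite adj_creationE vacE. Qed.

Lemma dot_creation H i (x y : fock d H) : dot (creation i x) y = dot x (adj (creation i) y).
Proof. exact: adjE (creation_bounded i) _ _. Qed.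

Lemma sum_creation_cons H (y : 'I_d -> fock d H) k v :
  \sum_(i < d) creation i (y i) (k :: v) = y k v.
Proof.
rewrite -[RHS](big_pred1_eq +%R k (fun i => y i v)) [RHS]big_mkcond.
by apply: eq_bigr => i _; rewrite [LHS]creationE eq_sym.
Qed.

(** The identity is the vacuum projection plus the sum of the L_i L_i^*; every recursion on the
    first letter rests on this. *)
Lemma fock_decomp H (x : fock d H) :
  x = vac d (x [::]) + \sum_(i < d) creation i (adj (creation i) x).
Proof.
apply: l2_eqP => -[|k v]; rewrite fockD fock_sumE vacE /=.
  by rewrite big1 ?addr0// => i _; rewrite creationE.
by rewrite add0r sum_creation_cons [RHS]adj_creationE.
Qed.

Lemma fock_dot H (x y : fock d H) :
  dot x y = dot (x [::]) (y [::]) +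
    \sum_(i < d) dot (adj (creation i) x) (adj (creation i) y).
Proof.
rewrite {1}[y]fock_decomp dotDr dot_vac dot_sumr; congr (_ + _).
by apply: eq_bigr => i _; rewrite (adjEl (creation_bounded i)).
Qed.

Lemma fock_norm H (x : fock d H) :
  `|x| ^+ 2 = `|x [::]| ^+ 2 + \sum_(i < d) `|adj (creation i) x| ^+ 2.
Proof. by rewrite -dotxx fock_dot dotxx; congr (_ + _); apply: eq_bigr => i _; rewrite dotxx. Qed.

Section MultiAnalytic.
Variables (H K : hilbertType R) (M : fock d H -> fock d K).
Hypothesis mM : multi_analytic M.
Let bM : bounded_op M. Proof. by case: mM. Qed.
Let lM : linear M. Proof. exact: bounded_op_linear. Qed.
Let ML i x : M (creation i x) = creation i (M x). Proof. by case: mM. Qed.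

Lemma multi_analytic_nil x : M x [::] = symbol M (x [::]) [::].
Proof.
rewrite {1}[x]fock_decomp (linD lM) (lin_sum lM) fockD fock_sumE big1 ?addr0// => i _.
by rewrite ML creationE.
Qed.

Lemma multi_analytic_cons x k v :
  M x (k :: v) = symbol M (x [::]) (k :: v) + M (adj (creation k) x) v.
Proof.
rewrite {1}[x]fock_decomp (linD lM) (lin_sum lM) fockD fock_sumE; congr (_ + _).
rewrite -[RHS](sum_creation_cons (fun i => M (adj (creation i) x))).
by apply: eq_bigr => i _; rewrite ML.
Qed.

Lemma adj_multi_analytic_nil y h : dot (adj M y [::]) h = dot y (symbol M h).
Proof. by rewrite -dot_vac (adjEl bM). Qed.

(** L_j^* M^* = (M L_j)^* = M^* L_j^*, and L_j^* L_k is I or 0. *)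
Lemma adj_creation_adj_creation j k y :
  adj (creation j) (adj M (creation k y)) = if j == k then adj M y else 0.
Proof.
apply: dotr_inj => x; rewrite (adjEl (creation_bounded j)) (adjEl bM) ML dot_creation.
rewrite adj_creation_creation eq_sym; case: (j == k); last by rewrite dot0r dot0l.
by rewrite (adjEl bM).
Qed.

Lemma adj_creation_adj_vac j g : adj (creation j) (adj M (vac d g)) = 0.
Proof.
apply: dotr_inj => x; rewrite (adjEl (creation_bounded j)) (adjEl bM) ML.
by rewrite dotC dot_creation adj_creation_vac dot0r dot0l conjC0.
Qed.

Lemma adj_multi_analytic_norm_creation k y :
  `|adj M (creation k y)| ^+ 2 = `|adj M (creation k y) [::]| ^+ 2 + `|adj M y| ^+ 2.
Proof.
rewrite [LHS]fock_norm; congr (_ + _).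
rewrite -[RHS](big_pred1_eq +%R k (fun=> `|adj M y| ^+ 2)) [RHS]big_mkcond.
apply: eq_bigr => j _; rewrite adj_creation_adj_creation.
by case: (j == k); rewrite // normr0 expr0n.
Qed.

Lemma adj_multi_analytic_norm_vac g :
  `|adj M (vac d g)| ^+ 2 = `|adj M (vac d g) [::]| ^+ 2.
Proof.
rewrite [LHS]fock_norm big1 ?addr0// => j _.
by rewrite adj_creation_adj_vac normr0 expr0n.
Qed.

End MultiAnalytic.

(** Each coordinate of M x is computed from the symbol by recursion on the word. *)
Lemma multi_analytic_symbol_inj H K (M N : fock d H -> fock d K) :
  multi_analytic M -> multi_analytic N -> symbol M = symbol N -> M = N.
Proof.
move=> mM mN MN; apply/funext => x; apply: l2_eqP => w.
elim: w x => [|k v IH] x.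
  by rewrite (multi_analytic_nil mM) (multi_analytic_nil mN) MN.
by rewrite (multi_analytic_cons mM) (multi_analytic_cons mN) MN IH.
Qed.

Lemma multopE H K (M : fock d H -> fock d K) : multi_analytic M -> multop (symbol M) = M.
Proof.
move=> mM; rewrite /multop; case: xgetP => [N _ [mN NM]|/(_ M)].
  exact: multi_analytic_symbol_inj.
by case.
Qed.

End FockSpace.

Arguments vac_linear {R d H}.
Arguments vac_bounded {R d H}.
Arguments creation_linear {R d H} i.
Arguments creation_bounded {R d H} i.

(** * The characteristic function *)

Section CharacteristicFunction.
Variables (R : realType) (d : nat) (H : hilbertType R) (A : 'I_d -> H -> H).
Hypothesis hA : row_contraction A.

Local Notation T := (rowop A).
Local Notation DA := (defect_space (rowop A)).
Local Notation DS := (defect_star_space (rowop A)).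

Let bA i : bounded_op (A i). Proof. by case: hA. Qed.
Let bT : bounded_op T. Proof. exact: rowop_bounded. Qed.
Let cT : contractive T. Proof. exact: row_contraction_contractive. Qed.
Let lT : linear T. Proof. exact: bounded_op_linear. Qed.
Let bT' : bounded_op (adj T). Proof. exact: adj_bounded. Qed.
Let lA' i : linear (adj (A i)). Proof. exact: adj_linear. Qed.

(** The restriction of the row operator to the defect space; the default 0 never occurs, by
    [defect_space_mem]. *)
Definition defect_row (u : DA) : DS := insubd 0 (T (csub_val u)).

Lemma defect_rowE u : csub_val (defect_row u) = T (csub_val u).
Proof. by apply: (insubdK (0 : DS)); exact: defect_space_mem. Qed.

Lemma defect_row_linear : linear defect_row.
Proof.
by move=> a x y; apply/val_inj; rewrite /= !defect_rowE [csub_val _]/= lT.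
Qed.

Definition next_state k (h : H) (u : DA) : H := adj (A k) h + defect T (csub_val u) k.

(* The output at the word w of the system with state space H, input x and
   initial state h whose colligation is the unitary Halmos extension of T. *)
Fixpoint output (w : seq 'I_d) (h : H) (x : fock d DA) : DS :=
  match w with
  | [::] => to_clran (defect_star T) h - defect_row (x [::])
  | k :: v => output v (next_state k h (x [::])) (adj (creation k) x)
  end.

Lemma output_nil h x :
  output [::] h x = to_clran (defect_star T) h - defect_row (x [::]).
Proof. by []. Qed.

Lemma output_cons k v h x :
  output (k :: v) h x = output v (next_state k h (x [::])) (adj (creation k) x).
Proof. by []. Qed.

(** The Halmos colligation is isometric: the cross terms <D_* h, T u> and <T^* h, D u> cancel by
    intertwining. *)
Lemma energy_balance h u :
  `|to_clran (defect_star T) h - defect_row u| ^+ 2 + \sum_(k < d) `|next_state k h u| ^+ 2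
  = `|h| ^+ 2 + `|u| ^+ 2.
Proof.
have -> : \sum_(k < d) `|next_state k h u| ^+ 2 = `|adj T h + defect T (csub_val u)| ^+ 2.
  rewrite l2_ord_norm; apply: eq_bigr => k _.
  by rewrite -[(adj T h + _) k]/(adj T h k + _) adj_rowop.
rewrite !csub_norm /= defect_rowE sqr_normD [X in _ + X]sqr_normD normrN dotNr.
rewrite (defect_star_norm bT cT) (defect_norm bT cT) (adjEl bT) (defect_intertwine bT cT).
rewrite (defect_star_sym bT cT) rmorphN /=; ring.
Qed.

Lemma output_linear w a h h' x x' :
  output w (a *: h + h') (a *: x + x') = a *: output w h x + output w h' x'.
Proof.
elim: w h h' x x' => [|k v IH] h h' x x'.
  rewrite !output_nil to_clran_linear fockD fockZ defect_row_linear scalerBr.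
  by rewrite opprD addrACA.
rewrite !output_cons -IH (adj_linear (creation_bounded k)); congr output.
rewrite /next_state lA' fockD fockZ /= linearP.
by rewrite -[(a *: _ + _ : l2 _ _) k]/(a *: defect T (csub_val (x [::])) k + _)
  scalerDr addrACA.
Qed.

(** Induction on the word length: the energy left after one step, plus that of the tails of the
    input, bounds the remaining outputs. *)
Lemma output_energy n (B : {fset seq 'I_d}) h x :
  (forall w, w \in B -> (size w < n)%N) ->
  \sum_(w <- B) `|output w h x| ^+ 2 <= `|h| ^+ 2 + `|x| ^+ 2.
Proof.
elim: n B h x => [|n IH] B h x Bn.
  rewrite big_seq big1 ?addr_ge0 ?exprn_ge0// => w /Bn.
  by rewrite ltn0.
apply: le_trans (sum_words_le _ _) _ => [w|]; first by rewrite exprn_ge0.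
rewrite [in leRHS]fock_norm addrA -energy_balance -addrA lerD2l -big_split /=.
by apply: ler_sum => k _; apply: IH; exact: size_word_tails.
Qed.

Lemma output_bound (B : {fset seq 'I_d}) h x :
  \sum_(w <- B) `|output w h x| ^+ 2 <= `|h| ^+ 2 + `|x| ^+ 2.
Proof.
apply: (@output_energy (\max_(w <- B) size w).+1) => w wB.
by rewrite ltnS (leq_bigmax_seq (F := fun w => size w)).
Qed.

Definition response h x : fock d DS := mkl2 (fun w => output w h x).

Lemma responseE h x w : response h x w = output w h x.
Proof. by apply: mkl2E; exists (`|h| ^+ 2 + `|x| ^+ 2) => B; exact: output_bound. Qed.

Lemma response_norm h x : `|response h x| ^+ 2 <= `|h| ^+ 2 + `|x| ^+ 2.
Proof.
apply: l2_norm_le => B; apply: le_trans (output_bound B h x).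
by apply: ler_sum => w _; rewrite responseE.
Qed.

Lemma response_linear a h h' x x' :
  response (a *: h + h') (a *: x + x') = a *: response h x + response h' x'.
Proof. by apply: l2_eqP => w; rewrite fockD fockZ !responseE output_linear. Qed.

(** The Poisson kernel (D_* A_w^* h)_w appears as the free response, with zero input; its
    boundedness is then an instance of the energy bound. *)
Definition poisson h : fock d DS := response h 0.

Lemma poissonE h w : poisson h w = to_clran (defect_star T) (adj (wordop A w) h).
Proof.
rewrite responseE; elim: w h => [|k v IH] h.
  by rewrite output_nil (lin0 defect_row_linear) subr0 adj_wordop_nil.
rewrite output_cons (lin0 (adj_linear (creation_bounded k))) IH adj_wordop_cons//.
by rewrite /next_state (_ : defect T (csub_val _) = 0) ?addr0// linear0.
Qed.

Lemma poisson_bounded : bounded_op poisson.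
Proof.
apply: contractive_bounded => [a x y|x].
  by rewrite -response_linear scaler0 addr0.
rewrite -sqr_norm_le; apply: le_trans (response_norm _ _) _.
by rewrite normr0 expr0n addr0.
Qed.

Lemma response0_multi_analytic : multi_analytic (response 0).
Proof.
have lM : linear (response 0) by move=> a x y; rewrite -response_linear scaler0 addr0.
split; last first.
  move=> i x; apply: l2_eqP => -[|k v]; rewrite [RHS]creationE responseE /=.
    by rewrite creationE (lin0 defect_row_linear) subr0 to_clran0.
  rewrite creationE /next_state (lin0 (lA' k)) add0r.
  rewrite (_ : defect T (csub_val _) = 0) ?linear0//.
  rewrite adj_creation_creation eq_sym; case: eqP => _; first by rewrite responseE.
  have -> : (0 : l2 'I_d H) k = 0 by [].
  by rewrite -[LHS]responseE (lin0 lM).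
apply: contractive_bounded => // x.
rewrite -sqr_norm_le; apply: le_trans (response_norm _ _) _.
by rewrite normr0 expr0n add0r.
Qed.

Lemma charfun_response : @charfun _ _ _ A = symbol (response 0).
Proof.
apply/funext => u; apply: l2_eqP => w; rewrite /symbol responseE.
(* Square summability of the family defining [charfun] is not known beforehand; it is read off from
   [output_bound] through this identity. *)
have E v : match v return DS with
    | [::] => - insubd 0 (T (csub_val u))
    | k :: v => to_clran (defect_star T) (adj (wordop A v) (defect T (csub_val u) k))
    end = output v 0 (vac d u).
  case: v => [|k v] /=.
    by rewrite to_clran0 sub0r vacE.
  rewrite adj_creation_vac vacE /= /next_state (lin0 (lA' k)) add0r.
  by rewrite -responseE -poissonE.
rewrite -E /charfun mkl2E//.
exists (`|(0 : H)| ^+ 2 + `|vac d u| ^+ 2) => B; apply: le_trans (output_bound B 0 (vac d u)).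
by apply: ler_sum => v _; rewrite E.
Qed.

Lemma charopE : charop A = response 0.
Proof. by rewrite /charop charfun_response multopE//; exact: response0_multi_analytic. Qed.

Lemma response_split h x : response h x = charop A x + poisson h.
Proof.
have := response_linear 1 0 h x 0.
by rewrite charopE !scale1r add0r addr0.
Qed.

Lemma charop_multi_analytic : multi_analytic (charop A).
Proof. by rewrite charopE; exact: response0_multi_analytic. Qed.

Lemma symbol_charop : symbol (charop A) = charfun A.
Proof. by rewrite charopE charfun_response. Qed.

Lemma charop_contractive : contractive (charop A).
Proof.
move=> x; rewrite charopE -sqr_norm_le; apply: le_trans (response_norm _ _) _.
by rewrite normr0 expr0n add0r.
Qed.

Lemma charfun_nil u : charfun A u [::] = - defect_row u.
Proof.
rewrite charfun_response /symbol responseE /= vacE /=.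
by rewrite to_clran0 sub0r.
Qed.

Lemma charfun_cons u k v : charfun A u (k :: v) =
  to_clran (defect_star T) (adj (wordop A v) (defect T (csub_val u) k)).
Proof.
rewrite charfun_response /symbol responseE /= vacE /= adj_creation_vac.
by rewrite /next_state (lin0 (lA' k)) add0r -responseE -poissonE.
Qed.

Lemma charfun_linear : linear (@charfun _ _ _ A).
Proof.
rewrite -symbol_charop => a x y; rewrite /symbol vac_linear.
exact: (bounded_op_linear charop_multi_analytic.1).
Qed.

Lemma adj_creation_charfun u k :
  adj (creation k) (charfun A u) = poisson (defect T (csub_val u) k).
Proof. by apply: l2_eqP => v; rewrite adj_creationE charfun_cons poissonE. Qed.

Lemma adj_creation_poisson h k : adj (creation k) (poisson h) = poisson (adj (A k) h).
Proof. by apply: l2_eqP => v; rewrite adj_creationE !poissonE adj_wordop_cons. Qed.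

(** Here |u|^2 - |A u|^2 = |D_A u|^2, and D_A is injective on its defect space. *)
Lemma charop_purely_contractive : purely_contractive (charop A).
Proof.
move=> u u0; rewrite symbol_charop /vacproj vac_norm charfun_nil normrN.
rewrite !csub_norm /= defect_rowE -(@ltr_pXn2r _ 2)// ?nnegrE//.
rewrite -subr_gt0 -(defect_norm bT cT) exprn_gt0// normr_gt0.
by apply: contra u0 => /eqP/(defect_space_inj bT cT)->.
Qed.

End CharacteristicFunction.

(** * The identity M M^* + K K^* = I for the Poisson kernel K *)

Section SzegoCondition.
Variables (R : realType) (d : nat) (H : hilbertType R) (A : 'I_d -> H -> H).
Hypothesis hA : row_contraction A.

Local Notation T := (rowop A).
Local Notation DA := (defect_space (rowop A)).
Local Notation DS := (defect_star_space (rowop A)).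
Local Notation M := (charop A).
Local Notation K := (poisson A).

Let bA i : bounded_op (A i). Proof. by case: hA. Qed.
Let bT : bounded_op T. Proof. exact: rowop_bounded. Qed.
Let cT : contractive T. Proof. exact: row_contraction_contractive. Qed.
Let lT : linear T. Proof. exact: bounded_op_linear. Qed.
Let mM : multi_analytic M. Proof. exact: charop_multi_analytic. Qed.
Let bM : bounded_op M. Proof. by case: mM. Qed.
Let cM : contractive M. Proof. exact: charop_contractive. Qed.
Let bK : bounded_op K. Proof. exact: poisson_bounded. Qed.

Lemma adj_poisson_creation k y : adj K (creation k y) = A k (adj K y).
Proof.
apply: dotl_inj => h; rewrite -(adjE bK) dotC dot_creation adj_creation_poisson//.
by rewrite -dotC (adjE bK) (adjEl (bA k)).
Qed.

Lemma adj_poisson_vac g : adj K (vac d g) = defect_star T (csub_val g).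
Proof.
apply: dotl_inj => h; rewrite -(adjE bK) dot_vac poissonE// adj_wordop_nil.
by rewrite -(defect_star_sym bT cT).
Qed.

Lemma adj_charop_creation_nil k y :
  adj M (creation k y) [::] = to_clran (defect T) (single k (adj K y)).
Proof.
apply: dotl_inj => u; rewrite dotC (adj_multi_analytic_nil mM) symbol_charop//.
rewrite dot_creation adj_creation_charfun// -(adjEl bK) -dotC.
by rewrite [RHS]csub_dot /= -(defect_sym bT cT) dot_single.
Qed.

Lemma adj_charop_vac_nil g : csub_val (adj M (vac d g) [::]) = - adj T (csub_val g).
Proof.
have /(insubdK (0 : DA)) E := defect_star_space_mem bT cT g.
suff -> : adj M (vac d g) [::] = - insubd 0 (adj T (csub_val g)).
  by rewrite /= -[csub_val _]/(\val (insubd (0 : DA) _)) E.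
apply: dotl_inj => u; rewrite dotC (adj_multi_analytic_nil mM) symbol_charop//.
rewrite dotC dot_vac charfun_nil// dotNl dotNr csub_dot defect_rowE//.
by rewrite conjCK (adjE bT) -[in LHS]E.
Qed.

(** Induction on the word: prefixing k replaces |K^* y|^2 by |A_k K^* y|^2, and the new vacuum
    coordinate of M^* contributes exactly the difference, the squared norm of a defect vector. *)
Lemma poisson_charop_norm_etens w g :
  `|adj K (etens w g)| ^+ 2 + `|adj M (etens w g)| ^+ 2 = `|g| ^+ 2.
Proof.
elim: w => [|k v IH].
  rewrite -/(vac d g) (adj_multi_analytic_norm_vac mM) adj_poisson_vac.
  by rewrite csub_norm /= adj_charop_vac_nil normrN (defect_star_norm bT cT) subrK csub_norm.
rewrite -creation_etens (adj_multi_analytic_norm_creation mM) adj_poisson_creation.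
rewrite adj_charop_creation_nil csub_norm /= (defect_norm bT cT).
rewrite rowop_single => [|i]; last exact: bounded_op_linear.
rewrite addrA [X in X + _]addrC subrK -[RHS]IH; congr (_ + _).
by rewrite -!dotxx dot_single singleE eqxx.
Qed.

(* The energy bound makes I - M M^* - K K^* positive, and its diagonal blocks
   vanish. *)
Lemma charop_poisson_decomp y : y = M (adj M y) + K (adj K y).
Proof.
pose Q z := z - (M (adj M z) + K (adj K z)).
have bQ : bounded_op Q.
  apply: bounded_opD; first exact: bounded_op_id.
  apply: bounded_opN; apply: bounded_opD; apply: bounded_op_comp => //; exact: adj_bounded.
have dQ z : dot (Q z) z = `|z| ^+ 2 - (`|adj K z| ^+ 2 + `|adj M z| ^+ 2).
  by rewrite dotBl dotDl (adjE bM) (adjE bK) !dotxx [X in _ - X]addrC.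
have pQ : positive_op Q.
  split=> // z; rewrite dQ subr_ge0.
  (* Cauchy-Schwarz and the energy bound give p^2 <= |z|^2 |[response]|^2 <= |z|^2 p, and p cancels
     when nonzero. *)
  set p := `|adj K z| ^+ 2 + _.
  have p0 : 0 <= p by rewrite addr_ge0 ?exprn_ge0.
  have E : response (adj K z) (adj M z) = M (adj M z) + K (adj K z).
    exact: response_split.
  have pE : p = dot (response (adj K z) (adj M z)) z.
    by rewrite E dotDl (adjE bM) (adjE bK) !dotxx addrC.
  have [p00|pn0] := eqVneq p 0; first by rewrite p00 exprn_ge0.
  have pp : 0 < p by rewrite lt_def pn0.
  rewrite -(ler_pM2r pp) -expr2.
  have := response_norm hA (adj K z) (adj M z); rewrite -/p => h.
  apply: le_trans (_ : (`|z| * `|response (adj K z) (adj M z)|) ^+ 2 <= _); last first.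
    by rewrite exprMn; apply: ler_wpM2l => //; rewrite exprn_ge0.
  rewrite -[p]ger0_norm// pE ler_pXn2r ?nnegrE ?mulr_ge0// mulrC.
  exact: Defs.CauchySchwarz.
have Qe w g : Q (etens w g) = 0.
  apply: positive_op_ker => //; rewrite dQ poisson_charop_norm_etens.
  apply/eqP; rewrite subr_eq0; apply/eqP.
  by rewrite -!dotxx dot_etens etensE eqxx.
apply/subr0_eq; rewrite -[LHS]/(Q y); apply: l2_eqP => w; apply: dotr_inj => g.
by rewrite -dot_etens (positive_op_sym pQ) Qe dot0r dot0l.
Qed.

(** Since D_*^2 = I - M M^* = K K^*, one has |D_* z| = |K^* z|. Factoring D_* = W K^* and taking
    adjoints gives D_* = K W^*. *)
Lemma charop_defect_star_range y : exists h, defect_star M y = K h.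
Proof.
have lD := bounded_op_linear (defect_star_bounded bM cM).
have [|W [lW cW WK]] := douglas_factor (bounded_op_linear (adj_bounded bK)) lD.
  move=> z; rewrite -sqr_norm_le (defect_star_norm bM cM).
  rewrite lerBlDr -!dotxx -(adjE bK) -(adjE bM) -dotDl addrC.
  by rewrite -charop_poisson_decomp.
have bW := contractive_bounded lW cW.
exists (adj W y); apply: dotr_inj => z; rewrite (defect_star_sym bM cM) -WK.
by rewrite -(adjEl bW) (adjE bK).
Qed.

End SzegoCondition.

(** * The Szego condition for observable row contractions *)

Section Observable.
Variables (R : realType) (d : nat) (H : hilbertType R) (A : 'I_d -> H -> H).
Hypothesis hA : row_contraction A.
Hypothesis oA : forall h,
  (forall w, defect_star (rowop A) (adj (wordop A w) h) = 0) -> h = 0.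

Local Notation T := (rowop A).
Local Notation M := (charop A).

Let bA i : bounded_op (A i). Proof. by case: hA. Qed.
Let bT : bounded_op T. Proof. exact: rowop_bounded. Qed.
Let cT : contractive T. Proof. exact: row_contraction_contractive. Qed.
Let lT : linear T. Proof. exact: bounded_op_linear. Qed.
Let mM : multi_analytic M. Proof. exact: charop_multi_analytic. Qed.
Let bM : bounded_op M. Proof. by case: mM. Qed.
Let cM : contractive M. Proof. exact: charop_contractive. Qed.

(** By observability the nonempty words give D_T u = T^* h; the empty word gives - T u = D_* h.
    Inserted in T D_T u = D_* T u this reads T T^* h = T T^* h - h, so h = 0 and then D_T u = 0. *)
Lemma poisson_charfun_eq0 h u : charfun A u = poisson A h -> u = 0.
Proof.
move=> uh.
have E : defect T (csub_val u) = adj T h.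
  apply: l2_eqP => k; rewrite adj_rowop//; apply/subr0_eq/oA => v.
  rewrite (linB (bounded_op_linear (adj_bounded (wordop_bounded v bA)))) linearB /=.
  have := congr1 (fun x : fock d (defect_star_space T) => csub_val (x (k :: v))) uh.
  by rewrite charfun_cons// poissonE// adj_wordop_cons//= => ->; rewrite subrr.
have F : - T (csub_val u) = defect_star T h.
  have := congr1 (fun x : fock d (defect_star_space T) => csub_val (x [::])) uh.
  by rewrite charfun_nil// poissonE// adj_wordop_nil /= defect_rowE.
have h0 : h = 0.
  have := defect_intertwine bT cT (csub_val u).
  rewrite E -[T (csub_val u)]opprK F linearN /= (defect_starK bT cT) opprB.
  by move=> /eqP; rewrite eq_sym subr_eq addrC -subr_eq subrr eq_sym => /eqP.
apply: (defect_space_inj bT cT).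
by rewrite E h0 (lin0 (adj_linear bT)).
Qed.

Lemma charop_defect_eq_vac v u : defect M v = vac d u -> u = 0.
Proof.
move=> vu; have [h hK] := charop_defect_star_range hA (M v).
apply: (@poisson_charfun_eq0 h); rewrite -hK -(defect_intertwine bM cM) vu.
by rewrite -symbol_charop.
Qed.

(** If v is orthogonal to the image under Delta of all creation ranges, then Delta v is supported at
    the empty word, so it vanishes by [charop_defect_eq_vac]. *)
Lemma charop_szego : szego M.
Proof.
pose L := @creation R d (defect_space T).
have bL : bounded_op (rowop L) by apply: rowop_bounded => i; exact: creation_bounded.
have lS : linear (defect M \o rowop L).
  by move=> a x y /=; rewrite (bounded_op_linear bL) linearP.
have L0 y : rowop L y [::] = 0.
  by rewrite /rowop fock_sumE big1// => i _; rewrite creationE.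
apply/seteqP; split; last first.
  by apply: closure_subset => _ [x _ <-]; exists x.
have sub : range (defect M) `<=`
    closure (defect M @` [set x | forall h, dot x (vac d h) = 0]).
  move=> _ [x _ <-].
  apply: (@closure_subset _ (range (defect M \o rowop L))).
    move=> _ [y _ <-]; exists (rowop L y) => // h.
    by rewrite dot_vac L0 dot0l.
  apply/(closure_rangeP _ lS) => v Sv.
  have Lv k : adj (creation k) (defect M v) = 0.
    apply: dotl_inj => y; rewrite dot0r -dot_creation -(defect_sym bM cM).
    have := Sv (single k y); rewrite /= rowop_single// => i.
    exact: creation_linear.
  have Dv : defect M v = vac d (defect M v [::]).
    by rewrite [LHS]fock_decomp big1 ?addr0// => i _; rewrite Lv (lin0 (creation_linear i)).
  by rewrite (defect_sym bM cM) Dv (charop_defect_eq_vac Dv) (lin0 vac_linear) dot0r.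
rewrite ((closure_id _).1 (@closed_closure _
  (defect M @` [set x | forall h, dot x (vac d h) = 0]))).
exact: closure_subset.
Qed.

End Observable.

(** * Ampliations I (x) g *)

Section Ampliation.
Variables (R : realType) (d : nat).
Implicit Types (H K : hilbertType R).

Lemma ampliation_linear H K (g : H -> K) : linear g -> contractive g ->
  linear (@ampliation R d H K g).
Proof.
move=> lg cg a x y; apply: l2_eqP => w.
by rewrite fockD fockZ !ampliationE// fockD fockZ lg.
Qed.

Lemma ampliation_contractive H K (g : H -> K) : contractive g ->
  contractive (@ampliation R d H K g).
Proof.
move=> cg x; rewrite -sqr_norm_le; apply: l2_norm_le => B.
apply: le_trans (l2_norm_ge x B); apply: ler_sum => w _.
by rewrite ampliationE// sqr_norm_le.
Qed.

Lemma ampliation_creation H K (g : H -> K) i x : linear g -> contractive g ->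
  @ampliation R d H K g (creation i x) = creation i (ampliation g x).
Proof.
move=> lg cg; apply: l2_eqP => w; rewrite ampliationE// !creationE.
case: w => [|j v]; first exact: lin0.
by case: (j == i); [rewrite ampliationE | exact: lin0].
Qed.

Lemma ampliation_vac H K (g : H -> K) h : linear g -> contractive g ->
  @ampliation R d H K g (vac d h) = vac d (g h).
Proof.
move=> lg cg; apply: l2_eqP => w; rewrite ampliationE// !vacE.
by case: eqP => // _; exact: lin0.
Qed.

Lemma ampliation_multi_analytic H K (g : H -> K) : linear g -> contractive g ->
  multi_analytic (@ampliation R d H K g).
Proof.
move=> lg cg; split; last by move=> i x; exact: ampliation_creation.
apply: contractive_bounded; [exact: ampliation_linear | exact: ampliation_contractive].
Qed.

(** The two norms are suprema over separate finite sets of words; passing to the union allows a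
    termwise comparison. *)
Lemma fock_norm2_le H K1 K2 (x : fock d H) (y : fock d K1) (z : fock d K2) :
  (forall w, `|y w| ^+ 2 + `|z w| ^+ 2 <= `|x w| ^+ 2) ->
  `|y| ^+ 2 + `|z| ^+ 2 <= `|x| ^+ 2.
Proof.
move=> yzx; rewrite -lerBrDr; apply: l2_norm_le => B.
rewrite lerBrDr -lerBrDl; apply: l2_norm_le => B'.
rewrite lerBrDl.
have mono (K : hilbertType R) (u : fock d K) (C E : {fset seq 'I_d}) : (C `<=` E)%fset ->
    \sum_(w <- C) `|u w| ^+ 2 <= \sum_(w <- E) `|u w| ^+ 2.
  move=> CE; rewrite [leRHS](@sum_fset_split R _ (fun w => `|u w| ^+ 2) C)//.
  by rewrite lerDl sumr_ge0// => w _; rewrite exprn_ge0.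
have h1 := mono _ y _ _ (fsubsetUl B B'); have h2 := mono _ z _ _ (fsubsetUr B B').
apply: le_trans (lerD h1 h2) _; rewrite -big_split /=.
by apply: le_trans (l2_norm_ge x (B `|` B')%fset); apply: ler_sum => w _.
Qed.

End Ampliation.

(** * The converse direction: the row symbol and its multi-analytic operator *)

Section RowSymbol.
Variables (R : realType) (d : nat) (H K : hilbertType R) (A : 'I_d -> H -> H).
Variable gamma : defect_star_space (rowop A) -> K.
Hypothesis hA : row_contraction A.
Hypotheses (lg : linear gamma) (cg : contractive gamma).

Local Notation T := (rowop A).
Local Notation DA := (defect_space (rowop A)).
Local Notation DS := (defect_star_space (rowop A)).
Local Notation N := (charop A).
Local Notation Dg := (defect_star gamma).
Local Notation Dgs := (defect_star_space gamma).

Let bg : bounded_op gamma. Proof. exact: contractive_bounded. Qed.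
Let bDg : bounded_op Dg. Proof. exact: defect_star_bounded. Qed.
Let lDg : linear Dg. Proof. exact: bounded_op_linear. Qed.
Let mN : multi_analytic N. Proof. exact: charop_multi_analytic. Qed.
Let bN : bounded_op N. Proof. by case: mN. Qed.
Let cN : contractive N. Proof. exact: charop_contractive. Qed.

Lemma rowsymbol_nil y :
  rowsymbol gamma y [::] = Dg (csub_val y.1) + gamma (charfun A y.2 [::]).
Proof. by rewrite /rowsymbol fockD vacE ampliationE. Qed.

Lemma rowsymbol_cons y k v : rowsymbol gamma y (k :: v) = gamma (charfun A y.2 (k :: v)).
Proof. by rewrite /rowsymbol fockD vacE /= add0r ampliationE. Qed.

Lemma rowsymbol_linear : linear (rowsymbol gamma).
Proof.
move=> a x y; rewrite /rowsymbol.
have -> : (a *: x + y).2 = a *: x.2 + y.2 by [].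
have -> : csub_val (a *: x + y).1 = a *: csub_val x.1 + csub_val y.1 by [].
rewrite charfun_linear// (ampliation_linear lg cg) lDg vac_linear scalerDr.
by rewrite addrACA.
Qed.

Lemma rowsymbol_bounded : bounded_op (rowsymbol gamma).
Proof.
apply/bounded_opP; split; first exact: rowsymbol_linear.
exists 2%:R => [|y]; first exact: ler0n.
apply: le_trans (ler_normD _ _) _; rewrite mulr_natl mulr2n; apply: lerD.
  rewrite vac_norm; apply: le_trans (defect_star_contractive bg cg _) _.
  by rewrite -csub_norm -sqr_norm_le hsum_norm lerDl exprn_ge0.
apply: le_trans (ampliation_contractive cg _) _.
rewrite -symbol_charop//; apply: le_trans (cN _) _.
by rewrite vac_norm -sqr_norm_le hsum_norm lerDr exprn_ge0.
Qed.

Lemma rowsymbol_eq0 y : purely_contractive N -> szego N -> resolving gamma ->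
  rowsymbol gamma y = 0 -> y = 0.
Proof.
move=> pN sN rg; case: y => p u y0.
(* The resolving property is applied to the k-th component of D_A u. *)
have tail k v : charfun A u (k :: v) = 0.
  rewrite charfun_cons//; apply/val_inj => /=; apply: rg => w.
  by rewrite -charfun_cons// -(rowsymbol_cons (p, u)) y0.
have uE : charfun A u = vac d (charfun A u [::]).
  by apply: l2_eqP => -[|k v]; rewrite vacE //= tail.
have u0 : u = 0.
  apply/eqP/negPn/negP => un0.
  have := pN _ un0; rewrite symbol_charop// /vacproj -uE.
  suff -> : `|charfun A u| = `|u| by rewrite ltxx.
  apply: sqr_norm_eq; apply/eqP; rewrite eq_sym -subr_eq0; apply/eqP.
  have Nu : N (vac d u) = charfun A u by rewrite -symbol_charop.
  rewrite -(vac_norm d u) -Nu -(defect_norm bN cN) -dotxx.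
  (* By the Szego condition it suffices to test against Delta x with x vanishing at the empty word.
     Both e_0 (x) u and its image are supported at that word, while x and its image vanish there. *)
  suff cl : forall z, closure (range (defect N)) z -> dot z (defect N (vac d u)) = 0.
    by apply: cl; apply: subset_closure; exists (vac d u).
  rewrite sN => z; apply: closure_orth => _ [x /= xo <-].
  have x0 : x [::] = 0 by apply: dotr_inj => h; rewrite -dot_vac xo dot0l.
  rewrite (defect_dot bN cN) dot_vac x0 dot0l Nu uE dot_vac.
  by rewrite (multi_analytic_nil mN) x0 symbol_charop// (lin0 (charfun_linear hA)) dot0l subrr.
congr pair => //; apply: (defect_star_space_inj bg cg).
have := rowsymbol_nil (p, u); rewrite y0 u0 (lin0 (charfun_linear hA)) /=.
by rewrite (lin0 lg) addr0.
Qed.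

(** With z the image of (p, q) and D the operator [Dg], the sum |p - D z|^2 + |q - gamma^* z|^2
    equals |p|^2 + |q|^2 - |z|^2. *)
Lemma defect_star_row_contraction p q : `|Dg p + gamma q| ^+ 2 <= `|p| ^+ 2 + `|q| ^+ 2.
Proof.
set z := Dg p + gamma q.
have zz : dot p (Dg z) + dot q (adj gamma z) = `|z| ^+ 2.
  by rewrite -(defect_star_sym bg cg) -(adjE bg) -dotDl dotxx.
have := defect_star_norm bg cg z => e.
have zr : (`|z| ^+ 2)^* = `|z| ^+ 2 by apply/CrealP/ger0_real/exprn_ge0.
have Eac : (dot p (Dg z))^* = `|z| ^+ 2 - (dot q (adj gamma z))^*.
  by rewrite -{1}zr -zz rmorphD addrK.
have Ea : dot p (Dg z) = `|z| ^+ 2 - dot q (adj gamma z) by rewrite -zz addrK.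
have := addr_ge0 (exprn_ge0 2 (normr_ge0 (p - Dg z)))
  (exprn_ge0 2 (normr_ge0 (q - adj gamma z))).
rewrite (sqr_normD p) (sqr_normD q) !normrN !dotNr e !rmorphN /= Eac Ea.
rewrite -[_ <= `|p| ^+ 2 + _]subr_ge0 => h; apply: le_trans h _.
by rewrite le_eqVlt; apply/orP; left; apply/eqP; ring.
Qed.

Variables (D : hilbertType R) (sigma : D -> hsum Dgs DA).
Hypothesis us : unitary sigma.

Let ls : linear sigma. Proof. by case: us. Qed.
Let ns x : `|sigma x| = `|x|.
Proof. by apply: sqr_norm_eq; rewrite -!dotxx; case: us. Qed.

Let sigma1 x := (sigma x).1.
Let sigma2 x := (sigma x).2.

Let ls1 : linear sigma1. Proof. by move=> a x y; rewrite /sigma1 ls. Qed.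
Let ls2 : linear sigma2. Proof. by move=> a x y; rewrite /sigma2 ls. Qed.
Let ns12 x : `|sigma1 x| ^+ 2 + `|sigma2 x| ^+ 2 = `|x| ^+ 2.
Proof. by rewrite -ns hsum_norm. Qed.
Let cs1 : contractive sigma1.
Proof. by move=> x; rewrite -sqr_norm_le -ns12 lerDl exprn_ge0. Qed.
Let cs2 : contractive sigma2.
Proof. by move=> x; rewrite -sqr_norm_le -ns12 lerDr exprn_ge0. Qed.

(** Composing ampliations with [charop A] makes both multi-analyticity and a wordwise norm estimate
    available. *)
Definition rowsymbol_op (x : fock d D) : fock d K :=
  ampliation (fun h => Dg (csub_val (sigma1 h))) x +
  ampliation gamma (N (ampliation sigma2 x)).

Let lD1 : linear (fun h => Dg (csub_val (sigma1 h))).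
Proof. by move=> a x y; rewrite ls1 /= lDg. Qed.
Let cD1 : contractive (fun h => Dg (csub_val (sigma1 h))).
Proof.
move=> x; apply: le_trans (cs1 x).
by rewrite csub_norm; exact: defect_star_contractive.
Qed.

Lemma rowsymbol_op_multi_analytic : multi_analytic rowsymbol_op.
Proof.
have [b1 m1] := ampliation_multi_analytic d lD1 cD1.
have [b2 m2] := ampliation_multi_analytic d ls2 cs2.
have [b3 m3] := ampliation_multi_analytic d lg cg.
split; first by apply: bounded_opD => //; apply: bounded_op_comp => //; exact: bounded_op_comp.
move=> i x; rewrite /rowsymbol_op m1 m2 mN.2 m3.
by rewrite (linD (creation_linear i)).
Qed.

Lemma symbol_rowsymbol_op : symbol rowsymbol_op = rowsymbol gamma \o sigma.
Proof.
apply/funext => h; rewrite /symbol /rowsymbol_op !ampliation_vac//.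
by rewrite -[N _]/(symbol N (sigma2 h)) symbol_charop.
Qed.

Lemma rowsymbol_op_contractive : contractive rowsymbol_op.
Proof.
move=> x; rewrite -sqr_norm_le.
pose P := ampliation sigma1 x; pose S := ampliation sigma2 x.
have PS : `|P| ^+ 2 + `|S| ^+ 2 <= `|x| ^+ 2.
  by apply: fock_norm2_le => w; rewrite !ampliationE// ns12.
apply: le_trans PS; apply: le_trans (_ : `|P| ^+ 2 + `|N S| ^+ 2 <= _); last first.
  by rewrite lerD2l sqr_norm_le.
apply: l2_norm_le => B.
apply: le_trans (lerD (l2_norm_ge P B) (l2_norm_ge (N S) B)).
rewrite -big_split /=; apply: ler_sum => w _.
have E : rowsymbol_op x w = Dg (csub_val (P w)) + gamma (N S w).
  by rewrite /P /rowsymbol_op fockD !ampliationE.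
move: (defect_star_row_contraction (csub_val (P w)) (N S w)).
by rewrite -E -csub_norm.
Qed.

End RowSymbol.

(** * Isometric colligations *)

Section IsometricColligation.
Variables (R : realType) (d : nat) (H D L : hilbertType R).
Variable U : hsum L (l2 'I_d H) -> hsum H D.
Hypotheses (lU : linear U) (nU : forall p, `|U p| = `|p|).

Definition colligation_state (k : 'I_d) (h : H) : H := (U (0, single k h)).1.

Local Notation A := colligation_state.
Local Notation T := (rowop A).
Local Notation DA := (defect_space (rowop A)).
Local Notation DS := (defect_star_space (rowop A)).
Local Notation e l := ((U (l, 0)).1).
Local Notation f l := ((U (l, 0)).2).
Local Notation b x := ((U (0, x)).2).

Let inl_linear : linear (fun l : L => (l, 0) : hsum L (l2 'I_d H)).
Proof. by move=> a x y; rewrite -[RHS]/(a *: x + y, a *: 0 + 0) scaler0 addr0. Qed.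
Let inr_linear : linear (fun x : l2 'I_d H => (0, x) : hsum L (l2 'I_d H)).
Proof. by move=> a x y; rewrite -[RHS]/(a *: 0 + 0, a *: x + y) scaler0 addr0. Qed.

Let lUl : linear (fun l : L => U (l, 0)).
Proof. by move=> a x y; rewrite inl_linear lU. Qed.
Let lUr : linear (fun x : l2 'I_d H => U (0, x)).
Proof. by move=> a x y; rewrite inr_linear lU. Qed.

Let nUl l : `|e l| ^+ 2 + `|f l| ^+ 2 = `|l| ^+ 2.
Proof. by rewrite -hsum_norm nU hsum_norm normr0 expr0n addr0. Qed.
Let nUr x : `|(U (0, x)).1| ^+ 2 + `|b x| ^+ 2 = `|x| ^+ 2.
Proof. by rewrite -hsum_norm nU hsum_norm normr0 expr0n add0r. Qed.

Let le : linear (fun l : L => e l). Proof. by move=> a x y; rewrite lUl. Qed.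
Let lf : linear (fun l : L => f l). Proof. by move=> a x y; rewrite lUl. Qed.
Let lb : linear (fun x : l2 'I_d H => b x). Proof. by move=> a x y; rewrite lUr. Qed.
Let lr : linear (fun x : l2 'I_d H => (U (0, x)).1).
Proof. by move=> a x y; rewrite lUr. Qed.

Let be : bounded_op (fun l : L => e l).
Proof.
apply: contractive_bounded => // l.
by rewrite -sqr_norm_le -nUl lerDl exprn_ge0.
Qed.

Let lA k : linear (A k).
Proof. by move=> a x y; rewrite /A single_linear lr. Qed.

Let TE x : T x = (U (0, x)).1.
Proof. by rewrite [in RHS](single_decomp x) (lin_sum lr). Qed.

Lemma colligation_state_row_contraction : row_contraction A.
Proof.
apply: contractive_row_contraction => [k|x].
  apply: contractive_bounded => // h.
  rewrite -sqr_norm_le; apply: (@le_trans _ _ (`|single k h| ^+ 2)).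
    by rewrite -nUr lerDl exprn_ge0.
  by rewrite -!dotxx dot_single singleE eqxx.
by rewrite TE -sqr_norm_le -nUr lerDl exprn_ge0.
Qed.

Let hA := colligation_state_row_contraction.
Let bA k : bounded_op (A k). Proof. by case: hA. Qed.
Let bT : bounded_op T. Proof. exact: rowop_bounded. Qed.
Let cT : contractive T. Proof. exact: row_contraction_contractive. Qed.
Let lT : linear T. Proof. exact: bounded_op_linear. Qed.

Let Ull l m : dot (e l) (e m) + dot (f l) (f m) = dot l m.
Proof. by have := isometry_dot lU nU (l, 0) (m, 0); rewrite /dot /= /hsum_dot /= dot0r addr0. Qed.

Let Ulr l x : dot (f l) (b x) = - dot (e l) (T x).
Proof.
have := isometry_dot lU nU (l, 0) (0, x).
rewrite -[dot (U _) _]/(dot (e l) (U (0, x)).1 + dot (f l) (b x)) -TE.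
rewrite -[RHS]/(dot l 0 + dot 0 x) dot0l dot0r addr0 addrC => /eqP.
by rewrite addr_eq0 => /eqP.
Qed.

Let Urr x y : dot (b x) (b y) = dot (defect T x) (defect T y).
Proof.
rewrite (defect_dot bT cT); have := isometry_dot lU nU (0, x) (0, y).
rewrite -[dot (U _) _]/(dot (U (0, x)).1 (U (0, y)).1 + dot (b x) (b y)) -!TE.
by rewrite -[RHS]/(dot 0 0 + dot x y) dot0l add0r => <-; rewrite addrC addKr.
Qed.

(** The pair p = (e^* h, T^* h) is the adjoint of the first row of [U] at h, so |p|^2 = <(U p).1, h>
    <= |p| |h|. Hence |e^* h|^2 <= |h|^2 - |T^* h|^2. *)
Let adj_e_le h : `|adj (fun l => e l) h| <= `|to_clran (defect_star T) h|.
Proof.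
rewrite csub_norm /= -sqr_norm_le (defect_star_norm bT cT) lerBrDr.
pose p : hsum L (l2 'I_d H) := (adj (fun l => e l) h, adj T h).
rewrite -[leLHS](hsum_norm p) sqr_norm_le; apply: norm_le_dot => //.
have pE : p = ((p.1, 0) : hsum L (l2 'I_d H)) + ((0, p.2) : hsum L (l2 'I_d H)).
  by rewrite -[RHS]/(p.1 + 0, 0 + p.2) addr0 add0r.
have -> : dot p p = dot (U p).1 h.
  rewrite [in RHS]pE (linD lU) -[RHS]/(dot (e p.1 + (U (0, p.2)).1) h) -TE dotDl.
  by rewrite (adjE be) (adjE bT).
apply: le_trans (_ : `|dot (U p).1 h| <= _).
  rewrite real_ler_norm//.
  rewrite [in X in X \is _]pE (linD lU) -[(_ + _).1]/(e p.1 + (U (0, p.2)).1) -TE dotDl.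
  by rewrite (adjE be) (adjE bT) rpredD// ger0_real// dotxx_ge0.
apply: le_trans (Defs.CauchySchwarz _ _) _; rewrite mulrC; apply: ler_wpM2l => //.
by rewrite -(nU p) -sqr_norm_le hsum_norm lerDl exprn_ge0.
Qed.

Lemma exists_colligation_gamma : exists gamma : DS -> L,
  [/\ linear gamma, contractive gamma &
      forall h, gamma (to_clran (defect_star T) h) = adj (fun l => e l) h].
Proof.
have [|||gamma [lg cg gE]] := @douglas_factor R H DS L (to_clran (defect_star T))
  (adj (fun l => e l)); last by exists gamma.
- exact: to_clran_linear.
- exact: adj_linear.
- exact: adj_e_le.
Qed.

(** Isometry of [U] gives |b x| = |D_T x|; the Douglas factor is therefore isometric on a dense
    range. *)
Lemma exists_colligation_tau : exists tau : DA -> D,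
  [/\ linear tau, forall u, `|tau u| = `|u| &
      forall x, tau (to_clran (defect T) x) = b x].
Proof.
have n x : `|b x| = `|to_clran (defect T) x|.
  by apply: sqr_norm_eq; rewrite csub_norm /= -!dotxx Urr.
have [||x|tau [lt ct tE]] := @douglas_factor R (l2 'I_d H) DA D (to_clran (defect T))
  (fun x => b x).
- exact: to_clran_linear.
- exact: lb.
- by rewrite n.
exists tau; split=> // u.
apply: (douglas_factor_isometry lt ct (T := to_clran (defect T))) => [x|].
  by rewrite tE n.
exact: to_clran_dense.
Qed.



Variables (gamma : DS -> L) (tau : DA -> D).
Hypotheses (lg : linear gamma) (cg : contractive gamma).
Hypothesis gammaE : forall h, gamma (to_clran (defect_star T) h) = adj (fun l => e l) h.
Hypotheses (lt : linear tau) (nt : forall u, `|tau u| = `|u|).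
Hypothesis tauE : forall x, tau (to_clran (defect T) x) = b x.

Local Notation Dg := (defect_star gamma).
Local Notation Dgs := (defect_star_space gamma).

Let bg : bounded_op gamma. Proof. exact: contractive_bounded. Qed.
Let bt : bounded_op tau.
Proof. by apply: contractive_bounded => // u; rewrite nt. Qed.

Let adj_gammaE l : defect_star T (csub_val (adj gamma l)) = e l.
Proof.
apply: dotl_inj => h; rewrite -(defect_star_sym bT cT).
rewrite -[LHS]/(dot (to_clran (defect_star T) h) (adj gamma l)).
by rewrite -(adjE bg) gammaE (adjEl be).
Qed.

Lemma colligation_observability h :
  (forall w, gamma (to_clran (defect_star T) (adj (wordop A w) h)) = 0) ->
  forall w l, dot h (wordop A w (e l)) = 0.
Proof.
move=> gh w l; rewrite -(adjEl (wordop_bounded w bA)) -(adjEl be) -gammaE gh.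
by rewrite dot0l.
Qed.

Let row_adj_gamma (l : L) : DA := insubd 0 (adj T (csub_val (adj gamma l))).

Let row_adj_gammaE l : csub_val (row_adj_gamma l) = adj T (csub_val (adj gamma l)).
Proof. by apply: (insubdK (0 : DA)); exact: defect_star_space_mem. Qed.

Let row_adj_gamma_linear : linear row_adj_gamma.
Proof.
move=> a x y; apply/val_inj; rewrite /= !row_adj_gammaE.
by rewrite (adj_linear bg) [csub_val _]/= (adj_linear bT).
Qed.

(* f l minus its projection onto the range of tau *)
Let corner l : D := f l + tau (row_adj_gamma l).

Let corner_linear : linear corner.
Proof. by move=> a x y; rewrite /corner lf row_adj_gamma_linear lt scalerDr addrACA. Qed.

(** Isometry gives <f l, b x> = - <e l, T x>, while intertwining gives <T^* gamma^* l, D_T x> = <D_*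
    gamma^* l, T x> = <e l, T x>. *)
Let corner_orth l u : dot (corner l) (tau u) = 0.
Proof.
suff : adj tau (corner l) = 0 by move=> h; rewrite -(adjEl bt) h dot0l.
apply: to_clran_inj => x; rewrite [RHS]dot0l.
rewrite -[LHS]/(dot (adj tau (corner l)) (to_clran (defect T) x)) (adjEl bt) dotDl.
rewrite (isometry_dot lt nt) tauE Ulr csub_dot row_adj_gammaE (adjEl bT) /=.
by rewrite (defect_intertwine bT cT) -(defect_star_sym bT cT) adj_gammaE addNr.
Qed.

(** Follows from <f l, f m> = <l, m> - <e l, e m> together with e = D_* gamma^*. Thus [corner]
    reproduces the defect space of gamma^* inside [D]. *)
Let corner_f l m : dot (corner l) (f m) = dot (Dg l) (Dg m).
Proof.
have -> : f m = corner m - tau (row_adj_gamma m) by rewrite addrK.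
rewrite dotBr corner_orth subr0 {1}/corner dotDl [X in _ + X]dotC corner_orth conjC0 addr0.
rewrite /corner dotDr.
have -> : dot (f l) (tau (row_adj_gamma m)) = - dot (row_adj_gamma l) (row_adj_gamma m).
  have := corner_orth l (row_adj_gamma m).
  by rewrite dotDl (isometry_dot lt nt) => /eqP; rewrite addr_eq0 => /eqP.
rewrite csub_dot !row_adj_gammaE (defect_star_dot bg cg) -Ull csub_dot -!adj_gammaE.
rewrite (defect_star_dot bT cT); ring.
Qed.

Let corner_dot l m : dot (corner l) (corner m) = dot (Dg l) (Dg m).
Proof. by rewrite {2}/corner dotDr corner_orth addr0 corner_f. Qed.

Local Notation X := (hsum L (l2 'I_d H)).

(** The inverse of sigma is to send [target p] to [source p]; the two have equal norms and [target]
    has dense range. *)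
Let target (p : X) : hsum Dgs DA := (to_clran Dg p.1, to_clran (defect T) p.2).
Let source (p : X) : D := corner p.1 + b p.2.

Let target_linear : linear target.
Proof.
by move=> a p q; congr pair; exact: to_clran_linear.
Qed.

Let source_linear : linear source.
Proof.
move=> a p q; rewrite /source.
have -> : (a *: p + q).1 = a *: p.1 + q.1 by [].
have -> : (a *: p + q).2 = a *: p.2 + q.2 by [].
by rewrite corner_linear lb [RHS](_ : _ = a *: corner p.1 + a *: b p.2 + (corner q.1 + b q.2)) ?scalerDr// addrACA.
Qed.

Let target_source p : `|source p| = `|target p|.
Proof.
apply: sqr_norm_eq; rewrite hsum_norm /= !csub_norm /= sqr_normD -tauE corner_orth.
by rewrite conjC0 !addr0 tauE -!dotxx corner_dot Urr.
Qed.

Let target_dense q : closure (range target) q.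
Proof.
apply/(closure_rangeP _ target_linear) => r Tr; suff -> : r = 0 by rewrite dot0r.
case: r Tr => r1 r2 Tr; congr pair; apply: to_clran_inj => y; rewrite dotC /= dot0l.
  have := Tr (y, 0); rewrite -[dot _ _]/(dot (Dg y) (csub_val r1) +
    dot (to_clran (defect T) 0) r2) to_clran0 dot0l addr0 => ->.
  by rewrite conjC0.
have := Tr (0, y); rewrite -[dot _ _]/(dot (to_clran Dg 0) r1 +
    dot (defect T y) (csub_val r2)) to_clran0 dot0l add0r => ->.
by rewrite conjC0.
Qed.

Variable theta : D -> fock d L.
Hypotheses (bth : bounded_op theta) (ith : injective theta).
Hypothesis theta_nil : forall x l, dot (theta x [::]) l = dot x (f l).
Hypothesis theta_cons : forall x k v l,
  dot (theta x (k :: v)) l = dot x (b (single k (wordop A v (e l)))).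

Let theta_source p : theta (source p) = rowsymbol gamma (target p).
Proof.
case: p => l x; apply: l2_eqP => -[|k v]; apply: dotr_inj => m.
  rewrite theta_nil rowsymbol_nil // charfun_nil // dotDl corner_f dotDl /=.
  congr (_ + _); first by rewrite !(defect_star_sym bg cg).
  have -> : defect_row (to_clran (defect T) x) = to_clran (defect_star T) (T x).
    by apply/val_inj; rewrite /= defect_rowE//= (defect_intertwine bT cT).
  rewrite (linN lg) gammaE dotNl (adjEl be) dotC Ulr rmorphN /=.
  by rewrite -dotC.
rewrite theta_cons rowsymbol_cons// charfun_cons// gammaE (adjEl be).
rewrite (adjEl (wordop_bounded v bA)) dotDl -[b (single k _)]tauE corner_orth add0r.
by rewrite tauE Urr -(defect_sym bT cT) dot_single.
Qed.

(** The isometry [W] carrying [target] to [source] satisfies theta W = [rowsymbol gamma].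
    Injectivity of theta makes [W] surjective, and sigma is its adjoint. *)
Lemma colligation_factorization : exists sigma : D -> hsum Dgs DA,
  unitary sigma /\ theta = rowsymbol gamma \o sigma.
Proof.
have [|W [lW cW WE]] := douglas_factor target_linear source_linear.
  by move=> p; rewrite target_source.
have nW q : `|W q| = `|q|.
  apply: (douglas_factor_isometry lW cW (T := target)) => [p|]; first by rewrite WE.
  exact: target_dense.
have bW := contractive_bounded lW cW.
have thW : theta \o W = rowsymbol gamma.
  apply: (bounded_op_eq_dense _ _ target_linear target_dense) => [||p].
  - exact: bounded_op_comp.
  - exact: rowsymbol_bounded.
  - by rewrite /= WE theta_source.
(* A vector orthogonal to the range of [W] is orthogonal to all b x and f l, which are what the
   coordinates of theta z are tested against; so theta z = 0. *)
have ker z : (forall q, dot (W q) z = 0) -> z = 0.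
  move=> Wz; have src p : dot (source p) z = 0 by rewrite -WE.
  have bz x : dot (b x) z = 0.
    by have := src (0, x); rewrite /source (lin0 corner_linear) add0r.
  have fz l : dot (f l) z = 0.
    have := src (l, 0); rewrite /source (lin0 lb) addr0 dotDl.
    suff : adj tau z = 0 by move=> h; rewrite (adjE bt) h dot0r addr0.
    apply: to_clran_inj => x; rewrite [RHS]dot0l.
    by rewrite -[LHS]/(dot (adj tau z) (to_clran (defect T) x)) (adjEl bt) tauE dotC bz conjC0.
  apply: ith; rewrite (lin0 (bounded_op_linear bth)).
  apply: l2_eqP => -[|k v]; apply: dotr_inj => l; rewrite [RHS]dot0l.
    by rewrite theta_nil dotC fz conjC0.
  by rewrite theta_cons dotC bz conjC0.
have WK z : W (adj W z) = z.
  apply/esym/subr0_eq/ker => q.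
  by rewrite dotBr (isometry_dot lW nW) (adjE bW) subrr.
exists (adj W); split; last by apply/funext => z; rewrite -thW /= WK.
split; first exact: adj_linear.
  by move=> x y; rewrite (adjEl bW) WK.
move=> q; exists (W q); apply: dotr_inj => p.
by rewrite (adjEl bW) (isometry_dot lW nW).
Qed.

End IsometricColligation.

(** * Isometric realization of a contractive multi-analytic operator *)

Section Realization.
Variables (R : realType) (d : nat) (D L : hilbertType R).
Variable M : fock d D -> fock d L.
Hypotheses (mM : multi_analytic M) (cM : contractive M).

Local Notation H := (defect_star_space M).

Let bM : bounded_op M. Proof. by case: mM. Qed.
Let bM' : bounded_op (adj M). Proof. exact: adj_bounded. Qed.
Let lM' : linear (adj M). Proof. exact: bounded_op_linear. Qed.
Let tc : fock d L -> H := to_clran (defect_star M).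
Let ltc : linear tc. Proof. exact: to_clran_linear. Qed.

(** [U] is found by factoring [S0] through [T0]; evaluating at e_0 (x) l and at L_k a recovers its
    four blocks. *)
Let T0 (x : fock d L) : hsum L (l2 'I_d H) :=
  (x [::], mkl2 (fun i => tc (adj (creation i) x))).
Let S0 (x : fock d L) : hsum H D := (tc x, adj M x [::]).

Let T0_linear : linear T0.
Proof.
move=> a x y; congr pair; apply: l2_eqP => i.
rewrite -[(_ + _ : l2 _ _) i]/(a *: mkl2 (fun i => tc (adj (creation i) x)) i +
  mkl2 (fun i => tc (adj (creation i) y)) i) !l2_ord_mkl2E.
by rewrite (adj_linear (creation_bounded i)) ltc.
Qed.

Let S0_linear : linear S0.
Proof. by move=> a x y; congr pair; [exact: ltc | rewrite lM']. Qed.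

Let adj_creation_adj i x : adj (creation i) (adj M x) = adj M (adj (creation i) x).
Proof.
apply: dotl_inj => y; rewrite -dot_creation -!(adjE bM) mM.2.
by rewrite dot_creation.
Qed.

(** Splitting |x|^2 and |M^* x|^2 by first letter, with L_i^* M^* = M^* L_i^*, leaves the defect
    energies of the L_i^* x. *)
Let S0_norm x : `|S0 x| = `|T0 x|.
Proof.
apply: sqr_norm_eq; rewrite !hsum_norm /= csub_norm /= (defect_star_norm bM cM).
rewrite l2_ord_norm (fock_norm (adj M x)) (fock_norm x).
have -> : \sum_(i < d) `|mkl2 (fun i => tc (adj (creation i) x)) i| ^+ 2 =
   \sum_(i < d) `|adj (creation i) x| ^+ 2 - \sum_(i < d) `|adj (creation i) (adj M x)| ^+ 2.
  rewrite -sumrB; apply: eq_bigr => i _.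
  by rewrite l2_ord_mkl2E csub_norm /= (defect_star_norm bM cM) adj_creation_adj.
ring.
Qed.

Let T0_vac l : T0 (vac d l) = (l, 0).
Proof.
congr pair; first by rewrite vacE.
apply: l2_eqP => i; rewrite l2_ord_mkl2E adj_creation_vac.
exact: to_clran0.
Qed.

Let T0_creation k a : T0 (creation k a) = (0, single k (tc a)).
Proof.
congr pair; first by rewrite creationE.
apply: l2_eqP => i; rewrite l2_ord_mkl2E adj_creation_creation singleE.
by case: (i == k) => //; exact: to_clran0.
Qed.

Let T0_dense q : closure (range T0) q.
Proof.
apply/(closure_rangeP _ T0_linear) => r Tr; suff -> : r = 0 by rewrite dot0r.
case: r Tr => l h Tr; congr pair.
  apply: dotl_inj => m; have := Tr (vac d m); rewrite T0_vac.
  by rewrite -[dot _ _]/(dot m l + dot 0 h) dot0l addr0 dot0r.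
apply: l2_eqP => k; apply: to_clran_inj => a; rewrite dotC [RHS]dot0l.
have := Tr (creation k a); rewrite T0_creation.
rewrite -[dot _ _]/(dot 0 l + dot (single k (tc a)) h) dot0l add0r dotC dot_single.
by rewrite csub_dot -dotC => ->; rewrite conjC0.
Qed.

Lemma exists_realization : exists U : hsum L (l2 'I_d H) -> hsum H D,
  [/\ linear U, forall p, `|U p| = `|p|,
      forall h, (forall w l, dot h (wordop (colligation_state U) w (U (l, 0)).1) = 0) -> h = 0,
      forall x l, dot (symbol M x [::]) l = dot x (U (l, 0)).2 &
      forall x k v l, dot (symbol M x (k :: v)) l =
        dot x (U (0, single k (wordop (colligation_state U) v (U (l, 0)).1))).2].
Proof.
have [|U [lU cU UE]] := douglas_factor T0_linear S0_linear.
  by move=> x; rewrite S0_norm.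
have Uvac l : U (l, 0) = S0 (vac d l) by rewrite -T0_vac UE.
have Ucr k a : U (0, single k (tc a)) = S0 (creation k a) by rewrite -T0_creation UE.
(* These vectors Delta_* (e_w (x) l) detect every coordinate of Delta_* h, and Delta_* is injective
   on the state space: this is observability. *)
have Uw w l : wordop (colligation_state U) w (U (l, 0)).1 = tc (etens w l).
  elim: w => [|k v IH]; first by rewrite Uvac.
  rewrite -[LHS]/(colligation_state U k (wordop (colligation_state U) v (U (l, 0)).1)).
  by rewrite IH /colligation_state Ucr creation_etens.
have sE x w l : dot (symbol M x w) l = dot x (adj M (etens w l) [::]).
  by rewrite -dot_etens [LHS]dotC -(adj_multi_analytic_nil mM) -dotC.
exists U; split=> // [p|h oh|x l|x k v l].
- apply: (douglas_factor_isometry lU cU (T := T0)) => [x|]; first by rewrite UE S0_norm.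
  exact: T0_dense.
- apply: (defect_star_space_inj bM cM); apply: l2_eqP => w; apply: dotr_inj => l.
  by rewrite -dot_etens (defect_star_sym bM cM) dot0l -(oh w l) Uw.
- by rewrite Uvac sE.
- by rewrite Uw Ucr sE creation_etens.
Qed.

End Realization.

Lemma multi_analytic_factorization (R : realType) (d : nat) (D L : hilbertType R)
    (M : fock d D -> fock d L) :
  multi_analytic M -> contractive M -> injective (symbol M) ->
  exists (H : hilbertType R) (A : 'I_d -> H -> H)
    (gamma : defect_star_space (rowop A) -> L)
    (sigma : D -> hsum (defect_star_space gamma) (defect_space (rowop A))),
    [/\ row_contraction A,
        purely_contractive (charop A) /\ szego (charop A),
        [/\ linear gamma, contractive gamma & resolving gamma],
        unitary sigma &
        symbol M = rowsymbol gamma \o sigma].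
Proof.
move=> mM cM iM; have [U [lU nU oU U0 U1]] := exists_realization mM cM.
have hA := colligation_state_row_contraction lU nU.
have [gamma [lg cg gE]] := exists_colligation_gamma lU nU.
have [tau [lt nt tE]] := exists_colligation_tau lU nU.
have bs : bounded_op (symbol M).
  exact: (bounded_op_comp mM.1 vac_bounded).
have [sigma [us sE]] :=
  colligation_factorization lU nU lg cg gE lt nt tE bs iM U0 U1.
(* Vanishing of the gamma outputs already forces h = 0. This yields both the resolving property and,
   since gamma is linear, the observability needed for the Szego condition. *)
have obs h : (forall w, gamma (to_clran (defect_star (rowop (colligation_state U)))
    (adj (wordop (colligation_state U) w) h)) = 0) -> h = 0.
  by move=> gh; apply: oU; exact: (colligation_observability lU nU gE gh).
exists (defect_star_space M), (colligation_state U), gamma, sigma; split=> //.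
- split; first exact: charop_purely_contractive.
  apply: charop_szego => // h Dh; apply: obs => w.
  by rewrite (_ : to_clran _ _ = 0) ?(lin0 lg)//; apply/val_inj; rewrite /= Dh.
- by split=> // h /obs-> w; rewrite (lin0 (adj_linear (wordop_bounded w hA.1))) linear0.
Qed.

Theorem mainTheorem9 (R : realType) (d : nat) (HC D : hilbertType R)
    (C : 'I_d -> HC -> HC) (hC : row_contraction C) :
  (forall M : fock d D -> fock d (defect_space (rowop C)),
    multi_analytic M -> contractive M -> injective (symbol M) ->
    exists (HA : hilbertType R) (A : 'I_d -> HA -> HA)
      (gamma : defect_star_space (rowop A) -> defect_space (rowop C))
      (sigma : D -> hsum (defect_star_space gamma) (defect_space (rowop A))),
      [/\ row_contraction A,
          purely_contractive (charop A) /\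
            szego (charop A),
          [/\ linear gamma, contractive gamma & resolving gamma],
          unitary sigma &
          symbol M = rowsymbol gamma \o sigma]) /\
  (forall (HA : hilbertType R) (A : 'I_d -> HA -> HA)
      (gamma : defect_star_space (rowop A) -> defect_space (rowop C))
      (sigma : D -> hsum (defect_star_space gamma) (defect_space (rowop A))),
    row_contraction A ->
    purely_contractive (charop A) ->
    szego (charop A) ->
    linear gamma -> contractive gamma -> resolving gamma ->
    unitary sigma ->
    injective (rowsymbol gamma \o sigma) /\
    exists M : fock d D -> fock d (defect_space (rowop C)),
      [/\ multi_analytic M, contractive M & symbol M = rowsymbol gamma \o sigma]).
Proof.
split=> [M|HA A gamma sigma hA pA sA lg cg rg us].
  exact: multi_analytic_factorization.
split; last first.
  exists (rowsymbol_op sigma); split.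
  - exact: rowsymbol_op_multi_analytic.
  - exact: rowsymbol_op_contractive.
  - exact: symbol_rowsymbol_op.
have [ls ds _] := us.
move=> x y /= xy; apply/subr0_eq/dotxx_eq0; rewrite -ds.
have -> : sigma (x - y) = 0.
  apply: (rowsymbol_eq0 hA lg cg pA sA rg).
  by rewrite (linB ls) (linB (rowsymbol_linear hA lg cg)) xy subrr.
by rewrite dot0l.
Qed.
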